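(* Let $\nu$ be a prime polynomial in $R_\infty=\mathbb{F}_q[Y]$ and let $x_0\in X_\infty$ be an $A_\infty$-periodic point. There exists $c>0$ such that the set of $\xi\in\Omega$ having $c$-escape of mass is uncountable.
   Context: Let $q$ be a positive power of a prime $p$, $K=\mathbb{F}_q(Y)$, $R_\infty=\mathbb{F}_q[Y]$, $K_\infty=\mathbb{F}_q((Y^{-1}))$, and $X_\infty=\mathrm{PGL}_2(K_\infty)/\mathrm{PGL}_2(R_\infty)$. Via $g\,\mathrm{PGL}_2(R_\infty)\mapsto [g(R_\infty\times R_\infty)]$, the space $X_\infty$ is the space of homothety classes (under $K_\infty^\times$) of $R_\infty$-lattices in $K_\infty\times K_\infty$, i.e. rank $2$ free $R_\infty$-submodules spanning $K_\infty\times K_\infty$ over $K_\infty$. Let $A_\infty$ be the diagonal subgroup of $\mathrm{PGL}_2(K_\infty)$, acting on $X_\infty$ on the left. A point $x\in X_\infty$ is $A_\infty$-periodic if its orbit $A_\infty x$ is compact; $\mu_x$ then denotes the unique $A_\infty$-invariant probability measure on $A_\infty x$. For a prime polynomial $\nu\in R_\infty$, the Hecke tree $T_\nu(x_0)$ is the connected component of $x_0$ in the graph with vertex set $X_\infty$, with an edge between two classes whenever they have representatives $\Lambda,\Lambda'$ with $\Lambda'\subset\Lambda$ and $\Lambda/\Lambda'\cong R_\infty/\nu R_\infty$ as $R_\infty$-modules. It is a regular tree. Let $\Omega$ be its boundary at infinity (set of ends). For $\xi\in\Omega$, $(x_n^\xi)_{n\in\mathbb{N}}$ denotes the sequence of vertices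 along the geodesic ray in $T_\nu(x_0)$ from $x_0$ to $\xi$. If $x_0$ is $A_\infty$-periodic, all vertices of $T_\nu(x_0)$ are $A_\infty$-periodic. For $\xi\in\Omega$, $\Theta_\xi$ is the set of weak-star accumulation points (tested against continuous functions with compact support) of the sequence of measures $(\mu_{x_n^\xi})_{n\in\mathbb{N}}$ on $X_\infty$. For $c>0$, $\xi$ has $c$-escape of mass if there exists $\theta\in\Theta_\xi$ with $\theta(X_\infty)\le 1-c$. *)

(* Defs.v *)
From HB Require Import structures.
From mathcomp Require Import all_boot all_order all_algebra.
From mathcomp Require Import all_classical all_reals all_analysis.
From mathcomp Require Import zify.

Set Implicit Arguments.
Unset Strict Implicit.
Unset Printing Implicit Defensive.

Import Order.TTheory GRing.Theory Num.Theory.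
Import numFieldNormedType.Exports.

Local Open Scope classical_set_scope.
Local Open Scope ring_scope.
Local Open Scope quotient_scope.

(* A formal Laurent series in 1/Y is given by its coefficients, indexed by the
   exponent of Y: [coef f n] is the coefficient of Y^n. *)
Record laurent (F : finFieldType) := Laurent {
  coef : int -> F;
  _ : `[< exists N : int, forall n, N < n -> coef n = 0 >] }.

HB.instance Definition _ (F : finFieldType) := [isSub for @coef F].
HB.instance Definition _ (F : finFieldType) := [Choice of laurent F by <:].

Section LaurentField.
Variable F : finFieldType.
Local Notation K := (laurent F).
Implicit Types f g h : K.

Lemma laurentP f g : coef f =1 coef g -> f = g.
Proof. by move=> fg; apply: val_inj; apply/funext. Qed.

Definition degree_le f (N : int) := forall n, N < n -> coef f n = 0.

Lemma degree_leP f : exists N, degree_le f N.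
Proof. exact/asboolP/(valP f). Qed.

Lemma degree_leW f (N M : int) : N <= M -> degree_le f N -> degree_le f M.
Proof. by move=> NM fN n Mn; apply: fN; apply: le_lt_trans Mn. Qed.

Lemma degree_le2 f g : exists N, degree_le f N /\ degree_le g N.
Proof.
have [a fa] := degree_leP f; have [b gb] := degree_leP g.
by exists (Num.max a b); split; [apply: degree_leW fa|apply: degree_leW gb];
  rewrite le_max lexx ?orbT.
Qed.

Lemma zero_subproof : `[< exists N : int, forall n, N < n -> (0 : F) = 0 >].
Proof. by apply/asboolP; exists 0. Qed.
Definition laurent_zero : K := Laurent zero_subproof.

Lemma opp_subproof f :
  `[< exists N : int, forall n, N < n -> - coef f n = 0 >].
Proof.
apply/asboolP; have [N fN] := degree_leP f; exists N => n /fN ->.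
by rewrite oppr0.
Qed.
Definition laurent_opp f : K := Laurent (opp_subproof f).

Lemma add_subproof f g :
  `[< exists N : int, forall n, N < n -> coef f n + coef g n = 0 >].
Proof.
apply/asboolP; have [N [fN gN]] := degree_le2 f g; exists N => n Nn.
by rewrite fN // gN // addr0.
Qed.
Definition laurent_add f g : K := Laurent (add_subproof f g).

Lemma laurent_addA : associative laurent_add.
Proof. by move=> f g h; apply: laurentP => n /=; rewrite addrA. Qed.
Lemma laurent_addC : commutative laurent_add.
Proof. by move=> f g; apply: laurentP => n /=; rewrite addrC. Qed.
Lemma laurent_add0 : left_id laurent_zero laurent_add.
Proof. by move=> f; apply: laurentP => n /=; rewrite add0r. Qed.
Lemma laurent_addN : left_inverse laurent_zero laurent_opp laurent_add.
Proof. by move=> f; apply: laurentP => n /=; rewrite addNr. Qed.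

HB.instance Definition _ := GRing.isZmodule.Build K
  laurent_addA laurent_addC laurent_add0 laurent_addN.

Lemma one_subproof :
  `[< exists N : int, forall n, N < n -> (n == 0)%:R = 0 :> F >].
Proof. by apply/asboolP; exists 0 => n; case: eqP => // ->. Qed.
Definition laurent_one : K := Laurent one_subproof.

Lemma mul_subproof f g : `[< exists N : int, forall n, N < n ->
  \sum_(i \in [set: int]) coef f i * coef g (n - i) = 0 >].
Proof.
apply/asboolP; have [a fa] := degree_leP f; have [b gb] := degree_leP g.
exists (a + b) => n abn; apply: fsbig1 => i _.
have [ai|ia] := ltP a i; first by rewrite fa // mul0r.
by rewrite gb ?mulr0 // ltrBrDr addrC; apply: le_lt_trans abn; rewrite lerD2r.
Qed.

(* The summand has finite support. *)
Definition laurent_mul f g : K := Laurent (mul_subproof f g).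

Lemma laurent_mul_seq f g n (r : seq int) : uniq r ->
    (forall i, i \notin r -> coef f i * coef g (n - i) = 0) ->
  coef (laurent_mul f g) n = \sum_(i <- r) coef f i * coef g (n - i).
Proof.
move=> ur fg0; rewrite fsbig_seq // /laurent_mul /=; apply/esym/fsbig_widen => //.
by move=> i [_ /negP /fg0].
Qed.

Definition trunc n f (a : int) : {poly F} := \poly_(k < n) coef f (a - k%:Z).

Lemma laurent_mulE n k f g a b : (k < n)%N -> degree_le f a -> degree_le g b ->
  coef (laurent_mul f g) (a + b - k%:Z) = (trunc n f a * trunc n g b)`_k.
Proof.
move=> kn fa gb.
rewrite (@laurent_mul_seq _ _ _ [seq a - j%:Z | j <- iota 0 k.+1]); first last.
- move=> i /mapP inr.
  have [ai|ia] := ltP a i; first by rewrite fa // mul0r.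
  rewrite gb ?mulr0 // ltNge; apply/negP => hb; apply: inr.
  by exists `|a - i|%N; rewrite ?mem_iota; lia.
- rewrite map_inj_uniq ?iota_uniq // => i j /addrI /oppr_inj.
  by case.
rewrite coefM big_map -[iota 0 k.+1]/(index_iota 0 k.+1) big_mkord.
apply: eq_bigr => j _; have jk : (j <= k)%N by rewrite -ltnS.
rewrite !coef_poly (leq_ltn_trans jk kn) (leq_ltn_trans (leq_subr _ _) kn).
by congr (_ * coef g _); lia.
Qed.

Lemma laurent_eqP f g c : degree_le f c -> degree_le g c ->
  (forall k : nat, coef f (c - k%:Z) = coef g (c - k%:Z)) -> f = g.
Proof.
move=> fc gc fg; apply: laurentP => n.
have [cn|nc] := ltP c n; first by rewrite fc // gc.
have := fg `|c - n|%N; rewrite gez0_abs ?subr_ge0 //.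
by rewrite opprB addrC subrK.
Qed.

Lemma degree_leM f g a b : degree_le f a -> degree_le g b ->
  degree_le (laurent_mul f g) (a + b).
Proof.
move=> fa gb n abn; apply: fsbig1 => i _.
have [ai|ia] := ltP a i; first by rewrite fa // mul0r.
by rewrite gb ?mulr0 // ltrBrDr addrC; apply: le_lt_trans abn; rewrite lerD2r.
Qed.

Lemma laurent_mulC : commutative laurent_mul.
Proof.
move=> f g; have [a fa] := degree_leP f; have [b gb] := degree_leP g.
apply: (@laurent_eqP _ _ (a + b)); first exact: degree_leM.
  by rewrite addrC; exact: degree_leM.
move=> k; rewrite (@laurent_mulE k.+1) //. rewrite mulrC -(@laurent_mulE k.+1) //.
by rewrite [b + a]addrC.
Qed.

Lemma laurent_mul3E k f g h a b c : degree_le f a -> degree_le g b ->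
    degree_le h c ->
  coef (laurent_mul (laurent_mul f g) h) (a + b + c - k%:Z) =
  (trunc k.+1 f a * trunc k.+1 g b * trunc k.+1 h c)`_k.
Proof.
move=> fa gb hc; rewrite (@laurent_mulE k.+1) //; last exact: degree_leM.
rewrite [LHS]coefM [RHS]coefM; apply: eq_bigr => j _.
by rewrite [in LHS]coef_poly ltn_ord (@laurent_mulE k.+1).
Qed.

Lemma laurent_mulA : associative laurent_mul.
Proof.
move=> f g h; have [a fa] := degree_leP f; have [b gb] := degree_leP g.
have [c hc] := degree_leP h.
rewrite laurent_mulC; apply: (@laurent_eqP _ _ (a + b + c)).
- by rewrite -addrA addrC; exact: degree_leM (degree_leM gb hc) fa.
- exact: degree_leM (degree_leM fa gb) hc.
move=> k; rewrite (laurent_mul3E k fa gb hc).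
have -> : a + b + c = b + c + a by rewrite -addrA addrC.
by rewrite (laurent_mul3E k gb hc fa) mulrC mulrA.
Qed.

Lemma laurent_mul1 : left_id laurent_one laurent_mul.
Proof.
move=> f; apply: laurentP => n.
rewrite (@laurent_mul_seq _ _ _ [:: 0]) //; last first.
  by move=> i; rewrite inE /= => /negPf ->; rewrite mul0r.
by rewrite big_seq1 /= mul1r subr0.
Qed.

Lemma laurent_mulDl : left_distributive laurent_mul +%R.
Proof.
move=> f g h; have [a [fa ga]] := degree_le2 f g.
have fga : degree_le (f + g) a by move=> n an; rewrite /= fa // ga // addr0.
have [b hb] := degree_leP h.
have fhb := degree_leM fa hb; have ghb := degree_leM ga hb.
apply: (@laurent_eqP _ _ (a + b)); first exact: degree_leM.
  move=> n an; rewrite [LHS](_ : _ = coef (laurent_mul f h) n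
    + coef (laurent_mul g h) n) //; by rewrite fhb // ghb // addr0.
move=> k; rewrite [RHS](_ : _ = coef (laurent_mul f h) (a + b - k%:Z)
  + coef (laurent_mul g h) (a + b - k%:Z)) // !(@laurent_mulE k.+1) //.
rewrite -coefD -mulrDl; congr (polyseq (_ * _))`_k.
by apply/polyP => i; rewrite coefD !coef_poly; case: ifP; rewrite ?addr0.
Qed.

Lemma laurent_one_neq0 : laurent_one != 0.
Proof.
apply/eqP => /(congr1 (fun f : K => coef f 0)) /= /eqP.
by rewrite oner_eq0.
Qed.

HB.instance Definition _ := GRing.Zmodule_isComNzRing.Build K
  laurent_mulA laurent_mulC laurent_mul1 laurent_mulDl laurent_one_neq0.

Fixpoint inv_seq (u : nat -> F) n : seq F :=
  if n is m.+1 then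
    rcons (inv_seq u m)
      ((u 0%N)^-1 * ((m == 0%N)%:R - \sum_(j < m) u (m - j)%N * (inv_seq u m)`_j))
  else [::].

Lemma size_inv_seq u n : size (inv_seq u n) = n.
Proof. by elim: n => //= n IH; rewrite size_rcons IH. Qed.

Lemma nth_inv_seq u n k : (k < n)%N -> (inv_seq u n)`_k = (inv_seq u k.+1)`_k.
Proof.
elim: n => // n IH; rewrite ltnS leq_eqVlt => /orP[/eqP -> //|kn].
by rewrite [LHS]/= nth_rcons size_inv_seq kn IH.
Qed.

Lemma inv_seqP u k : u 0%N != 0 ->
  \sum_(j < k.+1) (inv_seq u j.+1)`_j * u (k - j)%N = (k == 0%N)%:R.
Proof.
move=> u0; rewrite big_ord_recr /= subnn nth_rcons size_inv_seq ltnn eqxx.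
rewrite mulrAC mulVf // mul1r addrC; apply/eqP; rewrite eq_sym -subr_eq.
apply/eqP; congr (_ - _); apply: eq_bigr => j _.
by rewrite mulrC -(@nth_inv_seq _ k) // ltn_ord.
Qed.

Lemma laurent_invP f : f != 0 -> exists g, g * f = 1.
Proof.
move=> f0; have [N fN] := degree_leP f.
have [m fm] : exists k : nat, coef f (N - k%:Z) != 0.
  apply: contrapT => /forallNP fk; move/eqP: f0; apply.
  by apply: (@laurent_eqP _ _ N) => // k; apply/eqP/negPn/negP/fk.
case: (ex_minnP (ex_intro (fun k => coef f (N - k%:Z) != 0) m fm)).
move=> k fk kmin; pose a := N - k%:Z.
have fa : degree_le f a.
  move=> n an; have [Nn|nN] := ltP N n; first exact: fN.
  apply/eqP/negPn/negP => fn.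
  have := kmin `|N - n|%N; have -> : N - `|N - n|%N%:Z = n by lia.
  by move=> /(_ fn); move: an; rewrite /a; lia.
pose u i := coef f (a - i%:Z).
pose v (n : int) := if n <= - a then (inv_seq u `|(- a - n)%R|%N.+1)`_`|(- a - n)%R|
                    else 0.
have vP : `[< exists N : int, forall n, N < n -> v n = 0 >].
  by apply/asboolP; exists (- a) => n an; rewrite /v leNgt an.
exists (Laurent vP).
have ga : degree_le (Laurent vP) (- a).
  by move=> n an; rewrite /= /v leNgt an.
apply: (@laurent_eqP _ _ 0).
- by rewrite -(addNr a); exact: degree_leM.
- by move=> n n0; rewrite /= gt_eqF.
move=> j; rewrite -{1}(addNr a) (@laurent_mulE j.+1) //= coefM.
rewrite sub0r oppr_eq0 eqz_nat -(@inv_seqP u) /u ?subr0 //.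
apply: eq_bigr => i _; rewrite !coef_poly ltn_ord ltnS leq_subr.
congr (_ * _); rewrite /= /v ifT; last by rewrite lerBlDr lerDl.
by have -> : `|(- a - (- a - i%:Z))%R|%N = i by lia.
Qed.

Definition laurent_inv f : K := if f == 0 then 0 else xget 0 [set g | g * f = 1].

Lemma laurent_mulVf f : f != 0 -> laurent_inv f * f = 1.
Proof.
move=> f0; rewrite /laurent_inv (negPf f0).
exact: (xgetPex 0 (laurent_invP f0)).
Qed.

Lemma laurent_inv0 : laurent_inv 0 = 0.
Proof. by rewrite /laurent_inv eqxx. Qed.

HB.instance Definition _ := GRing.ComNzRing_isField.Build K
  laurent_mulVf laurent_inv0.

(* The (1/Y)-adic topology: the balls around [f] for the absolute value
   |h| = #|F| ^ deg h. *)
Definition laurent_ball f (N : int) : set K :=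
  [set g | forall n, N <= n -> coef g n = coef f n].

Definition laurent_nbhs f : set_system K :=
  filter_from [set: int] (laurent_ball f).

HB.instance Definition _ := hasNbhs.Build K laurent_nbhs.

Lemma laurent_nbhs_filter f : ProperFilter (nbhs f).
Proof.
apply: filter_from_proper; last by move=> N _; exists f.
apply: filter_from_filter; first by exists 0.
move=> N M _ _; exists (Num.min N M) => // g fg.
by split=> n nN; apply: fg; rewrite ge_min nN ?orbT.
Qed.

Lemma laurent_nbhs_singleton f (A : set K) : nbhs f A -> A f.
Proof. by case=> N _; apply. Qed.

Lemma laurent_nbhs_nbhs f (A : set K) : nbhs f A -> nbhs f (nbhs^~ A).
Proof.
case=> N _ sA; exists N => // g gf; exists N => // h hg.
by apply: sA => n Nn; rewrite hg // gf.
Qed.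

HB.instance Definition _ := Nbhs_isNbhsTopological.Build K
  laurent_nbhs_filter laurent_nbhs_singleton laurent_nbhs_nbhs.
HB.instance Definition _ := isPointed.Build K 0.

Lemma poly_subproof (p : {poly F}) : `[< exists N : int, forall n, N < n ->
  (if n is Posz k then p`_k else 0) = 0 >].
Proof.
apply/asboolP; exists (size p)%:Z => -[k|k] //.
by rewrite ltz_nat => /ltnW pk; rewrite nth_default.
Qed.

Definition laurent_poly (p : {poly F}) : K := Laurent (poly_subproof p).

Lemma laurent_poly_zmod : zmod_morphism laurent_poly.
Proof.
by move=> p q; apply: laurentP => -[k|k] /=; rewrite ?coefB ?oppr0 ?addr0.
Qed.

HB.instance Definition _ :=
  GRing.isZmodMorphism.Build {poly F} K laurent_poly laurent_poly_zmod.

Lemma laurent_poly_monoid : monoid_morphism laurent_poly.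
Proof.
split; first by apply: laurentP => -[k|k] //=; rewrite coef1.
move=> p q; apply: laurentP => -[k|k]; last first.
  rewrite (@laurent_mul_seq _ _ _ [::]) ?big_nil // => -[i|i] _ /=.
    by rewrite [_ - _](_ : _ = Negz (k + i)) ?mulr0 // !NegzE -opprD -PoszD addSn.
  by rewrite mul0r.
rewrite (@laurent_mul_seq _ _ _ [seq Posz j | j <- iota 0 k.+1]); first last.
- move=> -[i|i] /mapP inr; last by rewrite mul0r.
  have ki : (k < i)%N.
    by rewrite ltnNge; apply/negP => ik; apply: inr; exists i;
      rewrite // mem_iota add0n ltnS.
  rewrite [_ - _](_ : _ = Negz (i - k).-1) ?mulr0 //.
  by rewrite NegzE prednK ?subn_gt0 // -subzn 1?ltnW // opprB.
- by rewrite map_inj_uniq ?iota_uniq // => i j [].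
rewrite big_map -[iota 0 k.+1]/(index_iota 0 k.+1) big_mkord /= coefM.
by apply: eq_bigr => j _; rewrite subzn // -ltnS.
Qed.

HB.instance Definition _ :=
  GRing.isMonoidMorphism.Build {poly F} K laurent_poly laurent_poly_monoid.

Lemma laurent_poly_inj : injective laurent_poly.
Proof.
move=> p q pq; apply/polyP => k.
exact: (congr1 (fun f : K => coef f (Posz k)) pq).
Qed.

End LaurentField.

Definition GL2 (F : finFieldType) := {g : 'M[laurent F]_2 | g \in unitmx}.

HB.instance Definition _ (F : finFieldType) :=
  Topological.copy (GL2 F) (initial_topology (val : GL2 F -> 'M[laurent F]_2)).
HB.instance Definition _ (F : finFieldType) :=
  isPointed.Build (GL2 F) (exist _ 1%:M (unitmx1 (laurent F) 2)).

Section HeckeSpace.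
Variable F : finFieldType.
Local Notation K := (laurent F).
Local Notation R := {poly F}.
Local Notation iota := (@laurent_poly F).
Implicit Types g h : GL2 F.

Definition GL2_mul g h : GL2 F :=
  exist _ (val g *m val h)
    (eq_ind_r is_true (introT andP (conj (valP g) (valP h)))
              (unitmx_mul (val g) (val h))).

(* PGL_2(K) / PGL_2(R), with its quotient topology, is the quotient of GL_2(K)
   by the subgroup K^* GL_2(R) acting on the right; [same_coset] relates two
   matrices with the same image there. *)
Definition same_coset : rel (GL2 F) := fun g h =>
  `[< exists (k : K) (u : 'M[R]_2), [/\ k != 0, u \in unitmx &
        val h = k *: (val g *m map_mx iota u)] >].

Lemma same_coset_refl : reflexive same_coset.
Proof.
move=> g; apply/asboolP; exists 1, 1%:M; split; rewrite ?oner_neq0 ?unitmx1 //.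
by rewrite map_mx1 mulmx1 scale1r.
Qed.

Lemma same_coset_sym : symmetric same_coset.
Proof.
suff sym g h : same_coset g h -> same_coset h g.
  by move=> g h; apply/idP/idP; exact: sym.
move=> /asboolP[k [u [k0 uU hE]]]; apply/asboolP; exists k^-1, (invmx u).
split; rewrite ?invr_eq0 ?unitmx_inv // hE -scalemxAl scalerA mulVf //.
by rewrite scale1r -mulmxA -map_mxM mulmxV // map_mx1 mulmx1.
Qed.

Lemma same_coset_trans : transitive same_coset.
Proof.
move=> h g l /asboolP[k [u [k0 uU hE]]] /asboolP[k' [u' [k0' uU' lE]]].
apply/asboolP; exists (k' * k), (u *m u'); split.
- exact: mulf_neq0.
- by rewrite unitmx_mul uU.
- by rewrite lE hE -scalemxAl scalerA map_mxM mulmxA.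
Qed.

Canonical same_coset_equiv :=
  EquivRel same_coset same_coset_refl same_coset_sym same_coset_trans.

Definition X_infty := quotient_topology {eq_quot same_coset_equiv}.
HB.instance Definition _ := PointedTopological.on X_infty.
HB.instance Definition _ := Quotient.on X_infty.

Definition class_of (g : GL2 F) : X_infty := \pi_X_infty g.

Lemma class_of_eqP g h : class_of g = class_of h <-> same_coset g h.
Proof. by split=> [/eqquotP|gh]; last apply/eqquotP. Qed.

(* The R-lattice g (R x R) of K x K, in column vectors. *)
Definition lattice_of g : set 'cV[K]_2 :=
  [set v | exists w : 'cV[R]_2, v = val g *m map_mx iota w].

(* [x] is identified with a homothety class of lattices, which contains [L];
   see [same_coset_lattice]. *)
Definition represents (x : X_infty) (L : set 'cV[K]_2) :=
  exists2 g, class_of g = x & lattice_of g = L.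

Lemma same_coset_lattice g h : same_coset g h <->
  exists2 k : K, k != 0 & lattice_of h = [set k *: v | v in lattice_of g].
Proof.
split=> [/asboolP[k [u [k0 uU hE]]]|[k k0 hE]].
  exists k => //; apply/seteqP; split=> v /=.
    move=> [w ->]; exists (val g *m map_mx iota (u *m w)); first by exists (u *m w).
    by rewrite hE -scalemxAl map_mxM mulmxA.
  move=> [_ [w ->] <-]; exists (invmx u *m w).
  rewrite hE -scalemxAl map_mxM -mulmxA (mulmxA (map_mx iota u)) -map_mxM.
  by rewrite mulmxV // map_mx1 mul1mx.
have colP (a b : GL2 F) c : lattice_of b `<=` [set c *: v | v in lattice_of a] ->
    exists w : 'M[R]_2, val b = c *: (val a *m map_mx iota w).
  move=> ab.
  have colj j : exists w : 'cV[R]_2, col j (val b) = c *: (val a *m map_mx iota w).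
    have [|_ [w ->] <-] := ab (col j (val b)); last by exists w.
    exists (delta_mx j 0); rewrite map_delta_mx colE; congr (_ *m _).
  pose W j := xget 0 [set w | col j (val b) = c *: (val a *m map_mx iota w)].
  have WP j : col j (val b) = c *: (val a *m map_mx iota (W j)).
    exact: (xgetPex 0 (colj j)).
  exists (\matrix_(i, j) W j i 0); apply/matrixP => i j.
  have := congr1 (fun A : 'cV_2 => A i 0) (WP j).
  rewrite !mxE => ->; congr (_ * _); apply: eq_bigr => l _.
  by rewrite !mxE.
have [u hu] : exists u : 'M[R]_2, val h = k *: (val g *m map_mx iota u).
  by apply: colP; rewrite hE.
have [u' gu'] : exists u : 'M[R]_2, val g = k^-1 *: (val h *m map_mx iota u).
  apply: colP => v gv; exists (k *: v); first by rewrite hE; exists v.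
  by rewrite scalerA mulVf // scale1r.
apply/asboolP; exists k, u; split => //.
suff /mulmx1_unit[] : u *m u' = 1%:M by [].
have : val g *m map_mx iota (u *m u') = val g *m map_mx iota 1%:M.
  rewrite map_mx1 mulmx1 [RHS]gu' hu -scalemxAl scalerA mulVf // scale1r.
  by rewrite map_mxM mulmxA.
move=> /(congr1 (mulmx (invmx (val g)))); rewrite !mulmxA mulVmx ?(valP g) //.
by rewrite !mul1mx => /matrixP E; apply/matrixP => i j;
  apply: (@laurent_poly_inj F); have := E i j; rewrite !mxE.
Qed.

Definition A_infty : set (GL2 F) := [set a | is_diag_mx (val a)].

Definition GL2_act (a : GL2 F) (x : X_infty) : X_infty :=
  class_of (GL2_mul a (repr x)).

Lemma GL2_act_class_of a g : GL2_act a (class_of g) = class_of (GL2_mul a g).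
Proof.
apply/class_of_eqP; have /class_of_eqP := reprK (class_of g).
move=> /asboolP[k [u [k0 uU gE]]]; apply/asboolP; exists k, u; split => //=.
by rewrite gE -scalemxAr mulmxA.
Qed.

Definition A_orbit (x : X_infty) : set X_infty :=
  [set GL2_act a x | a in A_infty].

Definition A_periodic (x : X_infty) := compact (A_orbit x).

(* [L'] is contained in [L] and L / L' is isomorphic to R / (nu): there is a
   surjective R-linear map L -> R / (nu) with kernel L'. Such a map is given by
   [phi], whose values are representatives modulo [nu]. *)
Definition cyclic_quotient (nu : R) (L L' : set 'cV[K]_2) :=
  L' `<=` L /\ exists phi : 'cV[K]_2 -> R, [/\
    forall v w, L v -> L w -> nu %| phi (v + w) - (phi v + phi w),
    forall r v, L v -> nu %| phi (iota r *: v) - r * phi v,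
    forall r, exists2 v, L v & nu %| phi v - r &
    forall v, L v -> (nu %| phi v) = `[< L' v >] ].

Definition hecke_step (nu : R) (x y : X_infty) := exists L L',
  [/\ represents x L, represents y L' & cyclic_quotient nu L L'].

Definition hecke_edge (nu : R) (x y : X_infty) :=
  hecke_step nu x y \/ hecke_step nu y x.

Definition hecke_walk (nu : R) (n : nat) (x y : X_infty) :=
  exists p : nat -> X_infty, [/\ p 0%N = x, p n = y &
    forall i, (i < n)%N -> hecke_edge nu (p i) (p i.+1)].

Definition hecke_tree (nu : R) (x0 : X_infty) : set X_infty :=
  [set x | exists n, hecke_walk nu n x0 x].

Definition geodesic_ray (nu : R) (x0 : X_infty) (r : nat -> X_infty) :=
  [/\ forall n, hecke_tree nu x0 (r n),
      forall n, hecke_edge nu (r n) (r n.+1) &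
      forall m n k, hecke_walk nu k (r m) (r (m + n)%N) -> (n <= k)%N].

Definition same_end (r s : nat -> X_infty) :=
  exists m n, forall k, r (m + k)%N = s (n + k)%N.

Definition hecke_ends (nu : R) (x0 : X_infty) : set (set (nat -> X_infty)) :=
  [set [set s | geodesic_ray nu x0 s /\ same_end r s] |
     r in geodesic_ray nu x0].

End HeckeSpace.

Section Escape.
Variables (F : finFieldType) (rT : realType).
Local Notation X := (X_infty F).
Local Notation B := (g_sigma_algebraType (@open X)).

Definition orbit_measure (x : X) (mu : probability B rT) :=
  mu (A_orbit x) = 1%E /\
  forall (a : GL2 F) (A : set B), A_infty a -> measurable A ->
    mu (GL2_act a @^-1` A) = mu A.

Definition Cc := {f : X -> rT |
  `[< continuous f /\ compact (closure [set x | f x != 0]) >]}.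

(* A measure as a functional on Cc; its weak-star topology is the topology of
   pointwise convergence on Cc. *)
Definition functional (mu : {measure set B -> \bar rT}) : {ptws Cc -> rT} :=
  fun f => \int[mu]_x (val f x).

Definition finite_on_compacts (mu : {measure set B -> \bar rT}) :=
  forall A : set X, compact A -> (mu A < +oo)%E.

(* When the orbits of the [x n] are compact, [mu n] is uniquely determined. *)
Definition accumulation_measures (x : nat -> X) :
    set {measure set B -> \bar rT} :=
  [set theta | finite_on_compacts theta /\
    exists mu : nat -> probability B rT,
      (forall n, orbit_measure (x n) (mu n)) /\
      cluster ((fun n => functional (mu n)) @ \oo) (functional theta)].

(* In a tree, an end [xi] contains a unique ray [r] issued from [x0]. *)
Definition escape_of_mass (x0 : X) (c : rT) (xi : set (nat -> X)) :=
  exists r, [/\ xi r, r 0%N = x0 &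
    exists2 theta, accumulation_measures r theta &
      (theta [set: B] <= (1 - c)%:E)%E].

End Escape.

(* Main.v *)
Require Import Defs.
From HB Require Import structures.
From mathcomp Require Import all_boot all_order all_algebra.
From mathcomp Require Import all_classical all_reals all_analysis.
From mathcomp Require Import measurable_realfun.
From mathcomp Require Import zify ring lra.
From mathcomp Require finfield.

Set Implicit Arguments.
Unset Strict Implicit.
Unset Printing Implicit Defensive.

Import Order.TTheory GRing.Theory Num.Theory.
Import numFieldNormedType.Exports.

Local Open Scope classical_set_scope.
Local Open Scope ring_scope.

(** Modulo scalars, the diagonal group is the multiplicative group of [K], acting
    through [diag1 f = diag(f, 1)]; it is the product of the powers of [Y] and of the
    compact group of the series of degree [0].

    A class [class_of g] with compact orbit is fixed by [diag1 f] for some [f] of degree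
    [T > 0]: otherwise its orbit would be a countable disjoint union of translates of a
    compact set, which the invariant probability measure of the orbit excludes
    ([compact_orbit_period]). Hence [diag1 f * g = k * g * u] with a scalar [k] and a
    unit [u] of the ring of polynomial matrices.

    Given digits [beta : nat -> bool], let [b_n] be the sum of the [beta i * nu ^+ i] for
    [i < n] and let [M_n] be the matrix with rows [(1, 0)] and [(b_n, nu ^+ n)]. The
    classes of the [g * M_n] form a geodesic ray, and different digits give different
    ends ([ray_geodesic], [end_of_inj]). The escape of mass comes from two facts.

    - The [n]-th vertex is fixed by [diag1 (f ^+ J)] as soon as [u ^+ J] is trivial modulo
      [nu ^+ n]. In characteristic [p] the [p ^ m]-th power of [1 + nu *: N] is trivial
      modulo [nu ^+ (p ^ m)], so for [n] a power of [p] one can take [J] linear in [n]: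
      the orbit of the vertex has a period [T * n], for another constant [T]
      ([ray_period]).

    - If [b_n] has small degree compared with [n], the first column of [g * M_n], and of
      its translate by [diag1 f'] for [f'] of degree [t < n / 2], is a vector much shorter
      than the square root of the covolume. These translates lie far in the cusp, outside
      of any given compact set ([level_cuspidal], [compact_avoids_cusp]).

    Hence the orbit of the [n]-th vertex spends a proportion at least [1 / (2 * T)] of its
    period outside of a given compact set ([ray_escape]). Both facts apply to
    [n = p ^ (j.+1 ^ 2)] if the digits vanish except at the positions [p ^ (j ^ 2)], where
    they are arbitrary: this leaves uncountably many ends ([uncountable_range]).

    The measures are obtained as follows. The space of classes is Hausdorff and has a
    countable base of compact clopen sets, the orbits of the congruence subgroups
    ([X_countable_base]); so a finitely additive function on the compact clopen sets
    extends to a Borel measure, and the limits along an ultrafilter of such functions always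
    exist ([vague_limit]). This gives the invariant measure of a compact orbit, as a limit
    of averages over boxes of the diagonal group ([orbit_measure_exists]), and an
    accumulation point of the measures along a ray ([accumulation_exists]). *)

(** * Vague limits of finitely additive set functions *)

Section UltrafilterImage.

Lemma ultra_fmap (T U : Type) (f : T -> U) (G : set_system T) :
  UltraFilter G -> UltraFilter (f @ G).
Proof.
move=> GU; split=> [|H HF fGH]; first exact: fmap_proper_filter.
rewrite predeqE => A; split=> [HA|]; last exact: fGH.
have [//|GA] := in_ultra_setVsetC (f @^-1` A) GU.
have /fGH HnA : (f @ G) (~` A) by [].
by have /filter_ex [? []] : H (A `&` ~` A) by exact: filterI.
Qed.

Lemma ultra_cvg01 (R : realType) (T : Type) (G : set_system T) (u : T -> R) :
  UltraFilter G -> (forall t, 0 <= u t <= 1) -> cvg (u @ G).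
Proof.
move=> GU u01; have := @segment_compact R 0 1; rewrite compact_ultra => cpt.
have [|l [_ ul]] := cpt (u @ G) (ultra_fmap _ GU); last by apply/cvg_ex; exists l.
by rewrite /fmap /=; apply: (@filterE _ G) => t; rewrite /= in_itv /=; exact: u01.
Qed.

End UltrafilterImage.

Definition compact_clopen (T : topologicalType) : set (set T) :=
  [set C | [/\ compact C, open C & closed C]].

Section CompactClopen.
Variable T : topologicalType.
Implicit Types A B C : set T.

Lemma compact_clopen0 : compact_clopen (set0 : set T).
Proof. by split; [exact: compact0|exact: open0|exact: closed0]. Qed.

Lemma compact_clopenU A B :
  compact_clopen A -> compact_clopen B -> compact_clopen (A `|` B).
Proof.
by move=> [? ? ?] [? ? ?]; split; [exact: compactU|exact: openU|exact: closedU].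
Qed.

Lemma compact_clopenI A B :
  compact_clopen A -> open B -> closed B -> compact_clopen (A `&` B).
Proof.
move=> [cA oA kA] oB kB; split; [|exact: openI|exact: closedI].
by apply: (subclosed_compact _ cA); [exact: closedI|exact: subIsetl].
Qed.

Lemma compact_clopenD A B :
  compact_clopen A -> compact_clopen B -> compact_clopen (A `\` B).
Proof.
by move=> cA [_ oB kB]; apply: compact_clopenI; rewrite ?openC ?closedC.
Qed.

Lemma compact_open_cover C (A : nat -> set T) : compact C ->
  (forall i, open (A i)) -> C `<=` \bigcup_i A i ->
  exists n, C `<=` \big[setU/set0]_(i < n) A i.
Proof.
move=> /compact_near_coveringP cC oA CA.
pose P n x := (\big[setU/set0]_(i < n) A i) x.
have [x Cx|N _ NP] := cC nat \oo P _; last by exists N => x; exact: NP (leqnn N) x.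
have [i _ Aix] := CA x Cx; exists (A i, [set n | (i < n)%N]).
  by split; [apply: open_nbhs_nbhs; split; [exact: oA|]|exists i.+1].
move=> [y n] /= [Aiy iltn]; rewrite /P -bigcup_mkord.
by exists i.
Qed.

End CompactClopen.

(** An alias of [T] whose measurable sets are the compact clopen sets: they form a
    ring, on which a content can be defined. *)
Definition clopen_ring (T : Type) : Type := T.
Definition clopen_ring_display : measure_display.
Proof. by constructor. Qed.

Section ClopenRing.
Variable T : ptopologicalType.

HB.instance Definition _ := Pointed.on (clopen_ring T).
HB.instance Definition _ := @isRingOfSets.Build clopen_ring_display
  (clopen_ring T) (@compact_clopen T) (@compact_clopen0 T)
  (@compact_clopenU T) (@compact_clopenD T).

End ClopenRing.

Section VagueLimit.
Variables (R : realType) (T : ptopologicalType).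
Variable b : nat -> set T.
Hypothesis b_clopen : forall i, compact_clopen (b i).
Hypothesis b_base : forall U : set T, open U -> forall x, U x ->
  exists i, b i x /\ b i `<=` U.

Let B := g_sigma_algebraType (@open T).
Local Notation S := (clopen_ring T).
Local Notation I := (g_sigma_algebraType (@measurable _ S)).

(** An open set is the countable union of the sets of the base which it contains. *)
Lemma open_sub_sigma : <<s @open T >> `<=` <<s @compact_clopen T >>.
Proof.
apply: smallest_sub; first exact: smallest_sigma_algebra.
move=> U oU; pose bU i := if `[< b i `<=` U >] then b i else set0.
have -> : U = \bigcup_i bU i.
  apply/seteqP; split=> x.
    by move=> /(b_base oU)[i [bix biU]]; exists i => //; rewrite /bU asboolT.
  by move=> [i _]; rewrite /bU; case: asboolP => // biU; exact: biU.
have [_ _ /(_ bU)] := smallest_sigma_algebra setT (@compact_clopen T).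
apply=> i; apply: sub_sigma_algebra; rewrite /bU; case: asboolP => // _.
exact: compact_clopen0.
Qed.

Lemma sub_sigma_open : <<s @compact_clopen T >> `<=` <<s @open T >>.
Proof.
apply: smallest_sub; first exact: smallest_sigma_algebra.
by move=> C [_ oC _]; exact: sub_gen_smallest.
Qed.

Lemma measurable_id_sigma : measurable_fun setT (id : I -> B).
Proof. by move=> _ Y mY; rewrite setTI; exact: open_sub_sigma. Qed.

Lemma compact_clopen_measurable (C : set B) : compact_clopen C -> measurable C.
Proof. by move=> [_ + _]; exact: sub_sigma_algebra. Qed.

Variable m : set T -> R.
Hypothesis m_ge0 : forall A, 0 <= m A.
Hypothesis m_add : forall A C, compact_clopen A -> compact_clopen C ->
  A `&` C = set0 -> m (A `|` C) = m A + m C.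

Let m0 : m set0 = 0.
Proof.
have := m_add (@compact_clopen0 T) (@compact_clopen0 T) (setI0 set0).
by rewrite setU0 -[X in X = _]addr0 => /addrI.
Qed.

Definition clopen_content (A : set S) : \bar R := (m A)%:E.

Let clopen_content_ge0 A : (0 <= clopen_content A)%E.
Proof. by rewrite lee_fin. Qed.

Let clopen_content_additive : measure_function.semi_additive clopen_content.
Proof.
apply/additive2P; first by rewrite /clopen_content m0.
by move=> A C cA cC AC0; rewrite /clopen_content m_add.
Qed.

HB.instance Definition _ := @isContent.Build _ S R clopen_content
  clopen_content_ge0 clopen_content_additive.

Let clopen_content_sub : measurable_subset_sigma_subadditive clopen_content.
Proof.
move=> A F cF cA AF.
have [n An] : exists n, A `<=` \big[setU/set0]_(i < n) F i.
  apply: compact_open_cover => //; first by case: cA.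
  by move=> i; case: (cF i).
have mF k : measurable (F k : set S) by exact: cF.
apply: (@le_trans _ _ (\sum_(i < n) clopen_content (F i))%E).
  by apply: content_subadditive => // i _; exact: cF.
rewrite (nneseries_split 0 n) => [|k _]; last exact: clopen_content_ge0.
rewrite add0n big_mkord leeDl//; apply: nneseries_ge0 => k _ _.
exact: clopen_content_ge0.
Qed.

HB.instance Definition _ := @Content_SigmaSubAdditive_isMeasure.Build _ R S
  clopen_content clopen_content_sub.

(** By Caratheodory's theorem: on compact clopen sets, finite additivity implies
    countable subadditivity, since a countable cover by such sets has a finite
    subcover. *)
Lemma clopen_extension : exists theta : {measure set B -> \bar R},
  forall C, compact_clopen C -> theta C = (m C)%:E.
Proof.
pose mu := measure_extension clopen_content.
have mid := measurable_id_sigma.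
pose theta : {measure set B -> \bar R} :=
  measure_function_pushforward__canonical__measure_function_Measure mu mid.
exists theta => C cC.
by rewrite /= /pushforward preimage_id /mu /measure_extension measurable_mu_extE.
Qed.

End VagueLimit.

Section VagueConvergence.
Variables (R : realType) (T : ptopologicalType).
Variable b : nat -> set T.
Hypothesis b_clopen : forall i, compact_clopen (b i).
Hypothesis b_base : forall U : set T, open U -> forall x, U x ->
  exists i, b i x /\ b i `<=` U.

Local Notation B := (g_sigma_algebraType (@open T)).
Implicit Types theta mu : {measure set B -> \bar R}.

(** An open set is the increasing union of a sequence of compact clopen sets. *)
Lemma open_measure_le theta (U : set T) (r : \bar R) : open U ->
  (forall C, compact_clopen C -> C `<=` U -> (theta C <= r)%E) ->
  (theta U <= r)%E.
Proof.
move=> oU CUr; pose bU i := if `[< b i `<=` U >] then b i else set0.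
have bU_clopen i : compact_clopen (bU i).
  by rewrite /bU; case: asboolP => // _; exact: compact_clopen0.
pose V n := \big[setU/set0]_(i < n) bU i.
have V_clopen n : compact_clopen (V n).
  rewrite /V; elim: n => [|n IH]; first by rewrite big_ord0; exact: compact_clopen0.
  by rewrite big_ord_recr; exact: compact_clopenU.
have V_sub n : V n `<=` U.
  rewrite /V -bigcup_mkord => x [i _]; rewrite /bU.
  by case: asboolP => // biU; exact: biU.
have UV : \bigcup_n V n = U.
  apply/seteqP; split=> [x [n _ /V_sub]//|x /(b_base oU)[i [bix biU]]].
  exists i.+1 => //; rewrite /V -bigcup_mkord; exists i => //=.
  by rewrite /bU asboolT.
have mV n : measurable (V n : set B) by exact: compact_clopen_measurable.
have : theta (V n) @[n --> \oo] --> theta U.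
  rewrite -UV; apply: nondecreasing_cvg_mu => //; first exact: bigcupT_measurable.
  by move=> n k nk; apply/subsetPset; exact: subset_bigsetU.
move=> thV; rewrite -(cvg_lim _ thV)//; apply: lime_le.
  by apply/cvg_ex; exists (theta U).
by apply: nearW => n; exact: CUr.
Qed.

(** The compact clopen sets are stable by intersection and generate the Borel sets. *)
Lemma clopen_measure_unique mu theta : (mu setT < +oo)%E ->
  (forall C, compact_clopen C -> mu C = theta C) ->
  forall A, measurable A -> mu A = theta A.
Proof.
move=> mufin mutheta A mA.
have mE : (measurable : set (set B)) = <<s @compact_clopen T >>.
  apply/seteqP; split=> C.
    exact: (@open_sub_sigma T b b_clopen b_base).
  exact: sub_sigma_open.
apply: (@measure_unique _ R B (@compact_clopen T : set (set B)) (b :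
  nat -> set B) mE _ _ _ mu theta) => //.
- by move=> C D cC [_ oD kD]; exact: compact_clopenI.
- apply/seteqP; split=> // x _.
  by have [i [bix _]] := b_base openT (I : setT x); exists i.
- move=> k; apply: le_lt_trans mufin; apply: le_measure; rewrite ?inE//.
  by apply: compact_clopen_measurable.
Qed.

(** Around each point, [f] is constant up to [e] on a set of the base; finitely many
    such sets cover the support of [f], and can be made disjoint. *)
Lemma step_approx (f : T -> R) (e : R) : 0 < e -> continuous f ->
  compact (closure [set x | f x != 0]) ->
  exists n (C : nat -> set T) (c : nat -> R), (forall i, compact_clopen (C i)) /\
    forall x, `|f x - \sum_(i < n) c i * \1_(C i) x| <= e.
Proof.
move=> e0 cf cK; set K := closure _ in cK.
pose small i := exists c, forall x, b i x -> `|f x - c| <= e.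
pose A i := if `[< small i >] then b i else set0.
pose c i := xget 0 [set c | forall x, b i x -> `|f x - c| <= e].
have A_clopen i : compact_clopen (A i).
  by rewrite /A; case: asboolP => // _; exact: compact_clopen0.
have Ac i x : A i x -> `|f x - c i| <= e.
  by rewrite /A; case: asboolP => // si; exact: (xgetPex 0 si).
have KA : K `<=` \bigcup_i A i.
  move=> x _; have oU : open (f @^-1` ball (f x) e).
    by apply: open_comp => [y _|]; [exact: cf|exact: ball_open].
  have [|i [bix biU]] := b_base oU (_ : (f @^-1` ball (f x) e) x).
    exact: ballxx.
  exists i => //; rewrite /A asboolT //; exists (f x) => y /biU.
  by rewrite /= -ball_normE /= distrC => /ltW.
have [n Kn] := compact_open_cover cK (fun i => let: And3 _ o _ := A_clopen i in o) KA.
exists n, (seqDU A), c; split=> [i|x].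
  apply: compact_clopenD => //; elim: {n Kn} i => [|i IH].
    by rewrite big_ord0; exact: compact_clopen0.
  by rewrite big_ord_recr; exact: compact_clopenU.
have [|xn] := pselect ((\big[setU/set0]_(i < n) A i) x); last first.
  rewrite big1 => [|i _]; last first.
    rewrite indicE memNset ?mulr0 // => -[Aix _]; apply: xn.
    by rewrite -bigcup_mkord; exists i => //=.
  rewrite subr0.
  have [->|fx] := eqVneq (f x) 0; first by rewrite normr0 ltW.
  by case: xn; apply: Kn; exact: subset_closure.
rewrite bigsetU_seqDU -bigcup_mkord => -[j /= jn Ajx].
rewrite (bigD1 (Ordinal jn)) //= big1 => [|i ij]; last first.
  rewrite indicE memNset ?mulr0 // => Aix.
  have /trivIsetP := trivIset_seqDU A => /(_ i j I I).
  move=> /(_ ij) /seteqP[/(_ x)] + _; exact.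
by rewrite addr0 indicE mem_set // mulr1; apply: Ac; case: Ajx.
Qed.

Lemma normr_indic_le1 (A : set T) x : `|\1_A x : R| <= 1.
Proof. by rewrite indicE; case: (_ \in _); rewrite ?normr1 ?normr0. Qed.

Lemma bounded_integrable mu (f : B -> R) (M : R) : (mu setT < +oo)%E ->
  measurable_fun setT f -> (forall x, `|f x| <= M) ->
  mu.-integrable setT (EFin \o f).
Proof.
move=> mufin mf fM; apply: measurable_bounded_integrable => //.
exists M; split; first exact: num_real.
by move=> N MN x _; apply: le_trans (fM x) (ltW MN).
Qed.

Lemma step_integrable mu n (C : nat -> set T) (c : nat -> R) :
  (mu setT < +oo)%E -> (forall i, compact_clopen (C i)) ->
  mu.-integrable setT (EFin \o (fun x : B => \sum_(i < n) c i * \1_(C i) x)).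
Proof.
move=> mufin C_clopen; apply: (@bounded_integrable _ _ (\sum_(i < n) `|c i|)) => //.
  apply: measurable_sum => i; apply: measurable_funM; first exact: measurable_cst.
  by apply: measurable_indic; exact: compact_clopen_measurable.
move=> x; apply: le_trans (ler_norm_sum _ _ _) _; apply: ler_sum => i _.
by rewrite normrM ler_piMr // normr_indic_le1.
Qed.

Lemma Rintegral_step mu n (C : nat -> set T) (c : nat -> R) :
  (mu setT < +oo)%E -> (forall i, compact_clopen (C i)) ->
  \int[mu]_x (\sum_(i < n) c i * \1_(C i) x) = \sum_(i < n) c i * fine (mu (C i)).
Proof.
move=> mufin C_clopen; elim: n => [|n IH].
  under eq_Rintegral do rewrite big_ord0.
  by rewrite Rintegral_cst // mul0r big_ord0.
have mC i : measurable (C i : set B) by exact: compact_clopen_measurable.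
have iC : mu.-integrable setT (EFin \o (fun x : B => \1_(C n) x)).
  apply: (@bounded_integrable _ _ 1) => //.
  - exact: measurable_indic.
  - by move=> x; exact: normr_indic_le1.
under eq_Rintegral do rewrite big_ord_recr /=.
rewrite RintegralD //; first 1 last.
- exact: step_integrable.
- apply: (@bounded_integrable _ _ `|c n|) => //.
    by apply: measurable_funM; [exact: measurable_cst|exact: measurable_indic].
  by move=> x; rewrite normrM ler_piMr // normr_indic_le1.
rewrite IH big_ord_recr /=; congr (_ + _); rewrite RintegralZl //; congr (_ * _).
by rewrite /Rintegral integral_indic // setIT.
Qed.

Lemma continuous_measurable (f : T -> R) : continuous f ->
  measurable_fun setT (f : B -> R).
Proof.
move=> cf; apply: (measurability _ (RGenOpens.measurableE R)) => _ [_ [a [c ->] <-]].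
rewrite setTI; apply: sub_gen_smallest.
by apply: open_comp => [x _|]; [exact: cf|exact: interval_open].
Qed.

Lemma Rintegral_step_approx mu (f : T -> R) n (C : nat -> set T) (c : nat -> R) (e :
  R) :
  (mu setT <= 1)%E -> continuous f -> (forall i, compact_clopen (C i)) ->
  (forall x, `|f x - \sum_(i < n) c i * \1_(C i) x| <= e) ->
  `|\int[mu]_x (f x) - \sum_(i < n) c i * fine (mu (C i))| <= e.
Proof.
move=> mu1 cf C_clopen fe;
  have mufin : (mu setT < +oo)%E by exact: le_lt_trans mu1 (ltry _).
have e0 : 0 <= e by apply: le_trans (fe point).
have mf := continuous_measurable cf.
have istep := step_integrable n c mufin C_clopen.
have fi : mu.-integrable setT (EFin \o (f : B -> R)).
  apply: (@bounded_integrable _ _ (e + \sum_(i < n) `|c i|)) => // x.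
  rewrite -[f x](subrK (\sum_(i < n) c i * \1_(C i) x)).
  apply: le_trans (ler_normD _ _) _; apply: lerD => //.
  apply: le_trans (ler_norm_sum _ _ _) _; apply: ler_sum => i _.
  by rewrite normrM ler_piMr // normr_indic_le1.
have di : mu.-integrable setT
    (EFin \o (fun x : B => f x - \sum_(i < n) c i * \1_(C i) x)).
  apply: (@bounded_integrable _ _ e) => //; apply: measurable_funB => //.
  by move/integrableP: istep => [/measurable_EFinP].
rewrite -(Rintegral_step n c mufin C_clopen) -RintegralB //.
apply: le_trans (le_normr_Rintegral _ di) _ => //.
apply: (@le_trans _ _ (\int[mu]_(x in setT) e)).
  apply: le_Rintegral => //.
    apply: (@bounded_integrable _ _ e) => //.
      apply: measurableT_comp => //; apply: measurable_funB => //.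
      by move/integrableP: istep => [/measurable_EFinP].
    by move=> x; rewrite normr_id.
  by apply: (@bounded_integrable _ _ e) => // x; rewrite ger0_norm.
rewrite Rintegral_cst // ler_piMr // -lee_fin fineK //.
by rewrite ge0_fin_numE.
Qed.

(** Up to [e / 3], the integral of [f] is a combination of measures of compact clopen
    sets ([step_approx]). *)
Lemma vague_cvg (G : set_system nat) (mu : nat -> {measure set B -> \bar R}) theta
    (f : T -> R) : ProperFilter G ->
  (forall k, mu k setT <= 1)%E -> (theta setT <= 1)%E ->
  (forall C, compact_clopen C -> fine (mu k C) @[k --> G] --> fine (theta C)) ->
  continuous f -> compact (closure [set x | f x != 0]) ->
  \int[mu k]_x (f x) @[k --> G] --> \int[theta]_x (f x).
Proof.
move=> GF mu1 theta1 muC cf cK; apply/cvgrPdist_le => e e0.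
have e3 : 0 < e / 3 by rewrite divr_gt0.
have [n [C [c [C_clopen fC]]]] := step_approx e3 cf cK.
have : \sum_(i < n) c i * fine (mu k (C i)) @[k --> G] -->
       \sum_(i < n) c i * fine (theta (C i)).
  elim: n {fC} => [|n IH].
    by rewrite big_ord0; under eq_fun do rewrite big_ord0; exact: cvg_cst.
  rewrite big_ord_recr /=; under eq_fun do rewrite big_ord_recr /=.
  by apply: cvgD => //; apply: cvgM; [exact: cvg_cst|exact: muC].
move=> /cvgrPdist_le /(_ _ e3); apply: filterS => k.
have := Rintegral_step_approx (mu1 k) cf C_clopen fC.
have := Rintegral_step_approx theta1 cf C_clopen fC.
set x := Rintegral _ _ _; set y := Rintegral _ _ _; set u := \sum_(i < n) _.
set v := \sum_(i < n) _ => xu yv uv.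
have -> : x - y = (x - u) + ((u - v) + (v - y)).
  by rewrite !addrA subrK subrK.
have -> : e = e / 3 + (e / 3 + e / 3) by lra.
apply: le_trans (ler_normD _ _) _; apply: lerD => //.
by apply: le_trans (ler_normD _ _) _; apply: lerD => //; rewrite distrC.
Qed.

(** Along an ultrafilter, the bounded families [m k C] converge for all [C] at once,
    and the limit inherits finite additivity. *)
Lemma vague_limit (G : set_system nat) (m : nat -> set T -> R) :
  UltraFilter G -> (forall k A, 0 <= m k A <= 1) ->
  (forall k A C, compact_clopen A -> compact_clopen C -> A `&` C = set0 ->
    m k (A `|` C) = m k A + m k C) ->
  exists theta : {measure set B -> \bar R}, forall C, compact_clopen C ->
    exists2 r, theta C = r%:E & m k C @[k --> G] --> r.
Proof.
move=> GU m01 m_add; pose l A := lim (m k A @[k --> G]).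
have ml A : m k A @[k --> G] --> l A by apply: ultra_cvg01 => k.
have l_ge0 A : 0 <= l A.
  by apply: (cvgr_to_ge (ml A)); apply: nearW => k; have /andP[] := m01 k A.
have l_add A C : compact_clopen A -> compact_clopen C -> A `&` C = set0 ->
    l (A `|` C) = l A + l C.
  move=> cA cC AC; apply: cvg_lim => //.
  by under eq_fun do rewrite m_add //; apply: cvgD.
have [theta thetaE] := clopen_extension b_clopen b_base l_ge0 l_add.
by exists theta => C cC; exists (l C); [exact: thetaE|exact: ml].
Qed.

End VagueConvergence.

Section Probability.
Variables (R : realType) (d : measure_display) (T : measurableType d).
Variable mu : {measure set T -> \bar R}.
Hypothesis mu1 : mu setT = 1%E.

Let P (A : set T) := mu A.
Let P0 : P set0 = 0%E. Proof. exact: measure0. Qed.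
Let P_ge0 A : (0 <= P A)%E. Proof. exact: measure_ge0. Qed.
Let P_additive : semi_sigma_additive P.
Proof. exact: measure_semi_sigma_additive. Qed.
HB.instance Definition _ := isMeasure.Build _ _ _ P P0 P_ge0 P_additive.
HB.instance Definition _ := Measure_isProbability.Build _ _ _ P mu1.

Lemma probability_of_measure :
  exists Q : probability T R, forall A, Q A = mu A.
Proof. by exists P. Qed.

End Probability.

(** * Degrees of Laurent series and of matrices *)

Section Degrees.
Variable F : finFieldType.
Local Notation K := (laurent F).
Implicit Types f g : K.

Lemma degree_leD f g N : degree_le f N -> degree_le g N -> degree_le (f + g) N.
Proof. by move=> fN gN n Nn; rewrite /= fN // gN // addr0. Qed.

Lemma degree_leN f N : degree_le f N -> degree_le (- f) N.
Proof. by move=> fN n Nn; rewrite /= fN // oppr0. Qed.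

Lemma degree_leB f g N : degree_le f N -> degree_le g N -> degree_le (f - g) N.
Proof. by move=> fN gN; apply: degree_leD => //; exact: degree_leN. Qed.

Lemma degree_le0 N : degree_le (0 : K) N.
Proof. by []. Qed.

Lemma degree_le1 : degree_le (1 : K) 0.
Proof. by move=> n n0; rewrite /= gt_eqF. Qed.

Lemma degree_le_mul f g a b :
  degree_le f a -> degree_le g b -> degree_le (f * g) (a + b).
Proof. exact: degree_leM. Qed.

Lemma degree_le_sum (I : Type) (r : seq I) (P : pred I) (h : I -> K) N :
  (forall i, degree_le (h i) N) -> degree_le (\sum_(i <- r | P i) h i) N.
Proof.
by move=> hN; apply: (big_ind (fun h => degree_le h N)) => // f g; exact: degree_leD.
Qed.

Lemma degree_le_poly (p : {poly F}) : degree_le (laurent_poly p) (size p).-1.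
Proof.
by move=> [k|k] //; rewrite ltz_nat => pk;
  rewrite /= nth_default // (leq_trans (leqSpred _)).
Qed.

Lemma degree_le_poly_ge0 (p : {poly F}) (N : int) : p != 0 ->
  degree_le (laurent_poly p) N -> 0 <= N.
Proof.
move=> p0 pN; rewrite leNgt; apply/negP => N0; have /eqP[] := p0.
by apply/polyP => k; rewrite coef0; apply: (pN (Posz k)); exact: lt_le_trans N0 _.
Qed.

Lemma coef_mul_top f g a b : degree_le f a -> degree_le g b ->
  coef (f * g) (a + b) = coef f a * coef g b.
Proof.
move=> fa gb; have := @laurent_mulE F 1 0 f g a b isT fa gb.
by rewrite subr0 => ->; rewrite coefM big_ord1 !coef_poly /= !subr0.
Qed.

Definition has_degree f (d : int) := degree_le f d /\ coef f d != 0.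

Lemma has_degree_ex f : f != 0 -> exists d, has_degree f d.
Proof.
move=> f0; have [N fN] := degree_leP f.
have [m fm] : exists k : nat, coef f (N - k%:Z) != 0.
  apply: contrapT => /forallNP fk; move/eqP: f0; apply.
  by apply: (@laurent_eqP _ _ _ N) => // k; apply/eqP/negPn/negP/fk.
have exm : exists k, coef f (N - Posz k) != 0 by exists m.
case: (ex_minnP exm) => k fk kmin; exists (N - k%:Z); split=> // n an.
have [Nn|nN] := ltP N n; first exact: fN.
apply/eqP/negPn/negP => fn.
have := kmin `|N - n|%N; have -> : N - Posz `|N - n|%N = n by lia.
by move=> /(_ fn); move: an; lia.
Qed.

Lemma has_degree_neq0 f d : has_degree f d -> f != 0.
Proof. by move=> [_]; apply: contraNneq => ->. Qed.

Lemma has_degree_le f d N : has_degree f d -> degree_le f N -> d <= N.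
Proof. by move=> [_ fd] fN; rewrite leNgt; apply: contraNN fd => /fN ->. Qed.

Lemma has_degree_uniq f d e : has_degree f d -> has_degree f e -> d = e.
Proof.
move=> fd fe; apply/le_anti/andP; split; apply: has_degree_le;
  by [exact: fd|exact: fe|case: fd|case: fe].
Qed.

Lemma has_degreeM f g d e :
  has_degree f d -> has_degree g e -> has_degree (f * g) (d + e).
Proof.
move=> [fd fd0] [ge ge0]; split; first exact: degree_le_mul.
by rewrite coef_mul_top // mulf_neq0.
Qed.

Lemma has_degree1 : has_degree (1 : K) 0.
Proof. by split; [exact: degree_le1|exact: oner_neq0]. Qed.

Lemma has_degreeV f d : has_degree f d -> has_degree f^-1 (- d).
Proof.
move=> fd; have f0 := has_degree_neq0 fd.
have [e ie] : exists e, has_degree f^-1 e by apply: has_degree_ex; rewrite invr_eq0.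
have := has_degreeM fd ie; rewrite divff // => /has_degree_uniq/(_ has_degree1).
by move=> de; have -> : - d = e by apply/eqP; rewrite eq_sym -addr_eq0 addrC de.
Qed.

Lemma has_degreeX f d n : has_degree f d -> has_degree (f ^+ n) (d *+ n).
Proof.
move=> fd; elim: n => [|n IH]; first exact: has_degree1.
by rewrite exprS mulrS; exact: has_degreeM.
Qed.

Lemma has_degree_near f g d e : has_degree f d -> degree_le (g - f) e -> e < d ->
  has_degree g d.
Proof.
move=> [fd fd0] gfe ed; split; last first.
  by have /eqP := gfe d ed; rewrite /= subr_eq0 => /eqP ->.
by rewrite -(subrK f g); apply: degree_leD => //; apply: degree_leW (ltW ed) gfe.
Qed.

Lemma degree_le_divl f g d N : has_degree f d ->
  degree_le (f * g) (d + N) -> degree_le g N.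
Proof.
move=> fd fg; have f0 := has_degree_neq0 fd.
have -> : g = f^-1 * (f * g) by rewrite mulKf.
have -> : N = - d + (d + N) by rewrite addKr.
by apply: degree_le_mul => //; case: (has_degreeV fd).
Qed.

Definition Yvar : K := laurent_poly 'X.

Lemma has_degreeY : has_degree Yvar 1.
Proof. by split; [case=> [[|[|k]]|k] //=;
  rewrite coefX|rewrite /= coefX oner_neq0]. Qed.

Lemma has_degreeYX t : has_degree (Yvar ^+ t) t%:Z.
Proof. by have := has_degreeX t has_degreeY; rewrite pmulrn intz. Qed.

Lemma has_degreeYz n : has_degree (Yvar ^ n) n.
Proof.
case: n => n; first exact: has_degreeYX.
by rewrite NegzE -exprnN; apply: has_degreeV; exact: has_degreeYX.
Qed.

Lemma has_degree_poly (p : {poly F}) : p != 0 ->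
  has_degree (laurent_poly p) (size p).-1.
Proof.
by move=> p0; split; [exact: degree_le_poly|rewrite /= -lead_coefE lead_coef_eq0].
Qed.

Lemma det2E (R : comNzRingType) (A : 'M[R]_2) :
  \det A = A 0 0 * A 1 1 - A 0 1 * A 1 0.
Proof.
rewrite (expand_det_row _ 0) !big_ord_recl big_ord0 /cofactor !det_mx11 !mxE /=.
rewrite (_ : lift 0 0 = 1); last by apply/val_inj.
rewrite (_ : lift 1 0 = 0); last by apply/val_inj.
by rewrite expr0 expr1 addr0 mul1r mulN1r mulrN.
Qed.

Definition mx_le m n (A : 'M[K]_(m, n)) (N : int) := forall i j, degree_le (A i j) N.

Section MatrixDegrees.
Variables m n p : nat.
Implicit Types (A : 'M[K]_(m, n)) (C : 'M[K]_(n, p)).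

Lemma mx_leW A (N M : int) : N <= M -> mx_le A N -> mx_le A M.
Proof. by move=> NM AN i j; exact: degree_leW NM (AN i j). Qed.

Lemma mx_leP A : exists2 N : int, 0 <= N & mx_le A N.
Proof.
have [N AN] : exists N : 'I_m -> 'I_n -> int, forall i j, degree_le (A i j) (N i j).
  have /choice[f fP] : forall ij, exists N, degree_le (A ij.1 ij.2) N.
    by move=> ij; exact: degree_leP.
  by exists (fun i j => f (i, j)) => i j; exact: (fP (i, j)).
exists (\sum_i \sum_j `|N i j|); first by do 2 apply: sumr_ge0 => ? _.
move=> i j; apply: degree_leW (AN i j).
rewrite (bigD1 i) //= (bigD1 j) //= -addrA; apply: le_trans (ler_norm _) _.
by rewrite lerDl addr_ge0 // sumr_ge0 // => ? _; rewrite ?sumr_ge0.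
Qed.

Lemma mx_leM A C a b : mx_le A a -> mx_le C b -> mx_le (A *m C) (a + b).
Proof.
by move=> Aa Cb i j; rewrite mxE; apply: degree_le_sum => l; exact: degree_le_mul.
Qed.

Lemma mx_leD A A' N : mx_le A N -> mx_le A' N -> mx_le (A + A') N.
Proof. by move=> AN A'N i j; rewrite mxE; exact: degree_leD. Qed.

Lemma mx_leN A N : mx_le A N -> mx_le (- A) N.
Proof. by move=> AN i j; rewrite mxE; exact: degree_leN. Qed.

End MatrixDegrees.

Lemma mx_leB m n (A A' : 'M[K]_(m, n)) N : mx_le A N -> mx_le A' N -> mx_le (A - A') N.
Proof. by move=> AN A'N; apply: mx_leD => //; exact: mx_leN. Qed.

Lemma mx_le1 n : mx_le (1%:M : 'M[K]_n) 0.
Proof. by move=> i j; rewrite mxE; case: (_ == _); [exact: degree_le1|]. Qed.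

End Degrees.
Arguments Yvar {F}.

(** * The congruence subgroups of GL_2 over Laurent series *)

Section Congruence.
Variable F : finFieldType.
Local Notation K := (laurent F).
Implicit Types g h u : GL2 F.

Definition toGL2 (A : 'M[K]_2) (AU : A \in unitmx) : GL2 F := exist _ A AU.

Definition GL2_one : GL2 F := exist _ 1%:M (unitmx1 K 2).

Definition GL2_inv g : GL2 F :=
  exist _ (invmx (val g)) (eq_ind_r is_true (valP g) (unitmx_inv (val g))).

Lemma GL2_mulA g h u : GL2_mul g (GL2_mul h u) = GL2_mul (GL2_mul g h) u.
Proof. by apply: val_inj; rewrite /= mulmxA. Qed.

Lemma GL2_mul1 g : GL2_mul GL2_one g = g.
Proof. by apply: val_inj; rewrite /= mul1mx. Qed.

Lemma GL2_mulr1 g : GL2_mul g GL2_one = g.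
Proof. by apply: val_inj; rewrite /= mulmx1. Qed.

Lemma GL2_mulV g : GL2_mul g (GL2_inv g) = GL2_one.
Proof. by apply: val_inj; rewrite /= mulmxV ?(valP g). Qed.

Lemma GL2_mulVl g : GL2_mul (GL2_inv g) g = GL2_one.
Proof. by apply: val_inj; rewrite /= mulVmx ?(valP g). Qed.

(** Compact open subgroups, which form a base of neighbourhoods of [1]. The shift of
    the index by one makes every matrix [A] with [mx_le (A - 1%:M) (- 1)] invertible,
    so that even [cong 0] is a group. *)
Definition cong (k : nat) : set (GL2 F) :=
  [set u | mx_le (val u - 1%:M) (- (k%:Z + 1))].

Lemma near1_unitmx (A : 'M[K]_2) : mx_le (A - 1%:M) (- 1) -> has_degree (\det A) 0.
Proof.
move=> A1; have := A1 0 0; have := A1 0 1; have := A1 1 0; have := A1 1 1.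
rewrite !mxE /= subr0 subr0 => A11 A10 A01 A00.
rewrite det2E; apply: (@has_degree_near _ (A 0 0 * A 1 1) _ 0 (- 1)) => //.
  rewrite -[X in has_degree _ X](addr0 0); apply: has_degreeM.
    exact: has_degree_near (has_degree1 _) A00 _.
  exact: has_degree_near (has_degree1 _) A11 _.
rewrite addrAC subrr add0r; apply: degree_leN.
by apply: degree_leW (degree_le_mul A01 A10).
Qed.

Lemma near1_GL2 (A : 'M[K]_2) : mx_le (A - 1%:M) (- 1) -> A \in unitmx.
Proof. by move=> /near1_unitmx /has_degree_neq0 A0; rewrite unitmxE unitfE. Qed.

Lemma congW k l : (l <= k)%N -> cong k `<=` cong l.
Proof. by move=> lk u; apply: mx_leW; lia. Qed.

Lemma cong_near1 k u : cong k u -> mx_le (val u - 1%:M) (- 1).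
Proof. by apply: mx_leW; lia. Qed.

Lemma cong_le0 k u : cong k u -> mx_le (val u) 0.
Proof.
move=> /cong_near1 u1; rewrite -(subrK 1%:M (val u)).
by apply: mx_leD; [apply: mx_leW u1|exact: mx_le1].
Qed.

Lemma cong_det k u : cong k u -> has_degree (\det (val u)) 0.
Proof. by move=> /cong_near1; exact: near1_unitmx. Qed.

Lemma cong1 k : cong k GL2_one.
Proof. by rewrite /cong /= subrr => i j; rewrite mxE; exact: degree_le0. Qed.

Lemma congM k u v : cong k u -> cong k v -> cong k (GL2_mul u v).
Proof.
move=> uk vk; rewrite /cong /=.
have -> : val u *m val v - 1%:M = (val u - 1%:M) *m val v + (val v - 1%:M).
  by rewrite mulmxBl mul1mx addrA subrK.
by apply: mx_leD => //; have := mx_leM uk (cong_le0 vk); rewrite addr0.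
Qed.

(** If the inverse [v] of [u] had an entry of degree [N > 0], the identity
    [v = 1 - (u - 1) v] would lower [N]. *)
Lemma congV k u : cong k u -> cong k (GL2_inv u).
Proof.
move=> uk; set v := invmx (val u).
have vE : v = 1%:M - (val u - 1%:M) *m v.
  by rewrite mulmxBl mul1mx mulmxV ?(valP u) // opprB addrCA subrr addr0.
have [N N0 vN] := mx_leP v; have {N0}[n Nn] : exists n : nat, N = n by exists `|N|%N;
  lia.
have v0 : mx_le v 0.
  elim: n N Nn vN => [|n IH] N ->; first by [].
  move=> vN; apply: (IH n%:Z) => //; rewrite vE; apply: mx_leB.
    by apply: mx_leW (@mx_le1 F 2).
  apply: mx_leW (mx_leM (cong_near1 uk) vN); lia.
rewrite /cong /= -/v.
have -> : v - 1%:M = - ((val u - 1%:M) *m v) by rewrite {1}vE addrC addKr.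
by apply: mx_leN; have := mx_leM uk v0; rewrite addr0.
Qed.

Lemma cong_conj g k : exists l, forall u, cong l u ->
  cong k (GL2_mul (GL2_mul g u) (GL2_inv g)).
Proof.
have [a a0 ga] := mx_leP (val g); have [b b0 gb] := mx_leP (invmx (val g)).
exists (k + `|a| + `|b|)%N => u ul; rewrite /cong /=.
have -> : val g *m val u *m invmx (val g) - 1%:M =
          val g *m (val u - 1%:M) *m invmx (val g).
  by rewrite mulmxBr mulmxBl mulmx1 mulmxV ?(valP g).
apply: mx_leW (mx_leM (mx_leM ga ul) gb); lia.
Qed.

End Congruence.

(** * The topology of the space of lattices *)

Section Topology.
Variable F : finFieldType.
Local Notation K := (laurent F).
Local Notation X := (X_infty F).
Implicit Types (g h u : GL2 F) (x y : X).

Definition mx_agree (n : int) (A B : 'M[K]_2) :=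
  forall i j (m : int), n <= m -> coef (A i j) m = coef (B i j) m.

Lemma mx_agreeP (k : nat) (A B : 'M[K]_2) :
  mx_agree (- k%:Z) A B <-> mx_le (A - B) (- (k%:Z + 1)).
Proof.
split=> AB i j m km.
  by rewrite !mxE /= AB ?subrr //; move: km; lia.
have := AB i j m; rewrite !mxE /= => AB0; apply/eqP; rewrite -subr_eq0; apply/eqP/AB0.
by move: km; lia.
Qed.

Lemma GL2_nbhs_agree g (A : set (GL2 F)) : nbhs g A ->
  exists n, forall h, mx_agree n (val h) (val g) -> A h.
Proof.
move=> [_ [[B oB <-] /= Bg BA]].
have [P gP PB] : nbhs (val g) B by apply: open_nbhs_nbhs.
have /choice[N NP] : forall ij : 'I_2 * 'I_2, exists N : int,
    laurent_ball (val g ij.1 ij.2) N `<=` P ij.1 ij.2.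
  by move=> ij; have [N _ NP] := gP ij.1 ij.2; exists N.
exists (- \sum_ij `|N ij|) => h hg; apply: BA; apply: PB => i j.
apply: (NP (i, j)) => m Nm; apply: hg; apply: le_trans Nm.
rewrite lerNl (bigD1 (i, j)) //=; apply: (@le_trans _ _ `|N (i, j)|).
  by rewrite -normrN ler_norm.
by rewrite lerDl sumr_ge0.
Qed.

Lemma GL2_agree_nbhs g (A : set (GL2 F)) (n : int) :
  (forall h, mx_agree n (val h) (val g) -> A h) -> nbhs g A.
Proof.
move=> nA; pose B := [set M : 'M[K]_2 | mx_agree n M (val g)].
have gB : nbhs (val g) B.
  exists (fun i j => laurent_ball (val g i j) n).
    by move=> i j; exists n.
  by move=> M MP i j m nm; exact: MP.
have cv : continuous (val : GL2 F -> 'M[K]_2).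
  exact: (@initial_continuous _ _ (val : GL2 F -> 'M[K]_2)).
have gvB : nbhs g (val @^-1` B) := cv g _ gB.
by apply: filterS gvB => h; exact: nA.
Qed.

(** Multiplying by a bounded matrix shifts degrees by a bounded amount, so the cosets
    of the subgroups [cong k] define the topology of coefficients. *)
Lemma GL2_nbhsP g (A : set (GL2 F)) :
  nbhs g A <-> exists k, forall u, cong k u -> A (GL2_mul u g).
Proof.
split=> [/GL2_nbhs_agree[n nA]|[k kA]].
  have [N N0 gN] := mx_leP (val g).
  exists (`|n| + `|N|)%N => u uk; apply: nA => i j m nm.
  have := mx_leM uk gN; rewrite mulmxBl mul1mx => /(_ i j m).
  rewrite !mxE /= => ugN; apply/eqP; rewrite -subr_eq0; apply/eqP/ugN.
  by move: nm; lia.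
have [N N0 gN] := mx_leP (invmx (val g)).
apply: (@GL2_agree_nbhs _ _ (- (k + `|N|)%N%:Z)) => h /mx_agreeP hg.
have -> : h = GL2_mul (GL2_mul h (GL2_inv g)) g.
  by rewrite -GL2_mulA GL2_mulVl GL2_mulr1.
apply: kA; rewrite /cong /=.
have -> : val h *m invmx (val g) - 1%:M = (val h - val g) *m invmx (val g).
  by rewrite mulmxBl mulmxV ?(valP g).
by apply: mx_leW (mx_leM hg gN); lia.
Qed.

Lemma GL2_act1 x : GL2_act (GL2_one F) x = x.
Proof. by rewrite /GL2_act GL2_mul1; exact: reprK. Qed.

Lemma class_of_repr x : class_of (repr x) = x.
Proof. exact: reprK. Qed.

Lemma GL2_actM g h x : GL2_act (GL2_mul g h) x = GL2_act g (GL2_act h x).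
Proof.
rewrite -[x]class_of_repr; move: (repr x) => l.
by rewrite !GL2_act_class_of GL2_mulA.
Qed.

Lemma GL2_actK g x : GL2_act (GL2_inv g) (GL2_act g x) = x.
Proof. by rewrite -GL2_actM GL2_mulVl GL2_act1. Qed.

Lemma GL2_actKV g x : GL2_act g (GL2_act (GL2_inv g) x) = x.
Proof. by rewrite -GL2_actM GL2_mulV GL2_act1. Qed.

(** The preimage of [W] in [GL2] is open when it contains small cosets [cong k g],
    and these correspond to the action of [cong k] on the quotient. *)
Lemma X_openP (W : set X) : open W <->
  forall x, W x -> exists k, forall u, cong k u -> W (GL2_act u x).
Proof.
have -> : open W = open (@class_of F @^-1` W) by [].
rewrite openE; split=> [oW x Wx|WP g /= Wg].
  have /GL2_nbhsP[k kW] : nbhs (repr x) (@class_of F @^-1` W).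
    by apply: oW; rewrite /= class_of_repr.
  by exists k => u /kW.
apply/GL2_nbhsP; have [k kW] := WP _ Wg.
by exists k => u /kW; rewrite GL2_act_class_of.
Qed.

Lemma GL2_openP (W : set (GL2 F)) : open W <->
  forall g, W g -> exists k, forall u, cong k u -> W (GL2_mul u g).
Proof.
by rewrite openE; split=> WP g Wg; apply/GL2_nbhsP; exact: WP.
Qed.

Lemma GL2_act_continuous g : continuous (GL2_act g).
Proof.
apply/continuousP => W /X_openP oW; apply/X_openP => x /oW[k kW].
have [l lk] := cong_conj g k; exists l => u /lk /kW.
by rewrite /= -!GL2_actM -!GL2_mulA GL2_mulVl GL2_mulr1.
Qed.

Lemma orbit_map_continuous x : continuous (fun g => GL2_act g x).
Proof.
apply/continuousP => W /X_openP oW; apply/GL2_openP => g /oW[k kW].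
by exists k => u /kW; rewrite /= GL2_actM.
Qed.

Lemma ultra_fin (T : Type) (I : finType) (f : T -> I) (G : set_system T) :
  UltraFilter G -> exists c, G (f @^-1` [set c]).
Proof.
move=> GU; apply: contrapT => /forallNP nG.
have : \forall t \near G, forall c, f t <> c.
  apply: filter_forall => c.
  by have [/nG|] := in_ultra_setVsetC (f @^-1` [set c]) GU.
by move=> /filter_ex[t /(_ (f t))].
Qed.

(** A bounded set of matrices is compact when it contains the limits of its
    sequences: the coefficients live in a finite field, so an ultrafilter fixes
    each of them. *)
Lemma GL2_compact (S : set (GL2 F)) (N : int) :
  (forall g, S g -> mx_le (val g) N) ->
  (forall M : 'M[K]_2, (forall n, exists2 g, S g & mx_agree n (val g) M) ->
     exists2 g, S g & val g = M) ->
  compact S.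
Proof.
move=> SN Scl; rewrite compact_ultra => G GU GS.
have /choice[c cP] : forall ijm : 'I_2 * 'I_2 * int, exists c,
    G [set g : GL2 F | coef (val g ijm.1.1 ijm.1.2) ijm.2 = c].
  by move=> ijm; exact: (ultra_fin (fun g : GL2 F =>
    coef (val g ijm.1.1 ijm.1.2) ijm.2)).
have cN i j m : N < m -> c (i, j, m) = 0.
  move=> Nm; have : G (S `&` [set g : GL2 F | coef (val g i j) m = c (i, j, m)]).
    by apply: filterI => //; exact: (cP (i, j, m)).
  move=> /filter_ex[g [Sg /= <-]].
  exact: SN.
have cdeg i j : `[< exists N : int, forall n, N < n -> c (i, j, n) = 0 >].
  by apply/asboolP; exists N => n; exact: cN.
pose M : 'M[K]_2 := \matrix_(i, j) Laurent (cdeg i j).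
have GM n : G [set g : GL2 F | mx_agree n (val g) M].
  have : G [set g : GL2 F | forall (k : 'I_`|N - n|.+1) (ij : 'I_2 * 'I_2),
      coef (val g ij.1 ij.2) (N - k%:Z) = c (ij, N - k%:Z)].
    apply: filter_forall => k; apply: filter_forall => -[i j].
    exact: (cP (i, j, N - k%:Z)).
  apply: filterS2 GS => g Sg gM i j m nm; rewrite mxE /=.
  have [Nm|mN] := ltP N m; first by rewrite (SN _ Sg) // cN.
  have km : (`|N - m| < `|N - n|.+1)%N by move: nm mN; lia.
  have := gM (Ordinal km) (i, j) => /=.
  by rewrite gez0_abs ?subr_ge0 // opprB addrCA subrr addr0.
have [g Sg gM] : exists2 g, S g & val g = M.
  apply: Scl => n; have : G (S `&` [set g : GL2 F | mx_agree n (val g) M]).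
    by apply: filterI => //; exact: GM.
  by move=> /filter_ex[g [Sg gM]]; exists g.
exists g; split=> // A /GL2_nbhs_agree[n nA].
by apply: filterS (GM n) => h hM; apply: nA; rewrite gM.
Qed.

Lemma cong_compact k : compact (cong k : set (GL2 F)).
Proof.
apply: (@GL2_compact _ 0) => [g|M MP]; first exact: cong_le0.
have M1 : mx_le (M - 1%:M) (- (k%:Z + 1)).
  apply/mx_agreeP => i j m km.
  have [g /mx_agreeP gk gM] := MP (- k%:Z).
  by rewrite -gM // gk.
have M0 : M \in unitmx by apply: near1_GL2; apply: mx_leW M1; lia.
by exists (toGL2 M0).
Qed.

Definition cong_ball k x : set X := [set GL2_act u x | u in cong k].

Lemma cong_ball_refl k x : cong_ball k x x.
Proof. by exists (GL2_one F); [exact: cong1|exact: GL2_act1]. Qed.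

Lemma cong_ball_sym k x y : cong_ball k x y -> cong_ball k y x.
Proof.
by move=> [u uk <-]; exists (GL2_inv u); [exact: congV|exact: GL2_actK].
Qed.

Lemma cong_ball_trans k x y z : cong_ball k x y -> cong_ball k y z -> cong_ball k x z.
Proof.
move=> [u uk <-] [v vk <-]; exists (GL2_mul v u); first exact: congM.
by rewrite GL2_actM.
Qed.

Lemma cong_ball_subset k l x : (l <= k)%N -> cong_ball k x `<=` cong_ball l x.
Proof. by move=> lk _ [u uk <-]; exists u => //; exact: congW lk _ uk. Qed.

Lemma cong_ball_stable_open k (W : set X) :
  (forall x y, W x -> cong_ball k x y -> W y) -> open W.
Proof.
by move=> WP; apply/X_openP => x Wx; exists k => u uk; apply: WP Wx _; exists u.
Qed.

(** The sets [cong_ball k x] are the orbits of the compact group [cong k], so they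
    form a partition into open sets. *)
Lemma cong_ball_compact_clopen k x : compact_clopen (cong_ball k x).
Proof.
split.
- apply: (@continuous_compact _ _ (fun u => GL2_act u x)); last exact: cong_compact.
  by apply: continuous_subspaceT; exact: orbit_map_continuous.
- by apply: (@cong_ball_stable_open k) => y z; exact: cong_ball_trans.
- rewrite -openC; apply: (@cong_ball_stable_open k) => y z xy yz xz; apply: xy.
  exact: cong_ball_trans xz (cong_ball_sym yz).
Qed.

Lemma open_cong_ball (W : set X) x : open W -> W x -> exists k, cong_ball k x `<=` W.
Proof. by move=> /X_openP oW /oW[k kW]; exists k => _ [u /kW Wu <-]. Qed.

Lemma nbhs_cong_ball k x : nbhs x (cong_ball k x).
Proof.
by apply: open_nbhs_nbhs; split;
  [case: (cong_ball_compact_clopen k x)|exact: cong_ball_refl].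
Qed.

Definition poly_mx (P : 'M[{poly F}]_2) : 'M[K]_2 := map_mx (@laurent_poly F) P.

(** Scaling by a power of [Y] and dropping the fractional parts approximates a
    class by the class of a matrix with polynomial entries. *)
Lemma poly_class_dense k x : exists (P : 'M[{poly F}]_2) (h : GL2 F),
  val h = poly_mx P /\ cong_ball k (class_of h) x.
Proof.
have [N N0 gN] := mx_leP (val (repr x)); set g := repr x in gN.
have [a a0 ga] := mx_leP (invmx (val g)).
pose t := (k + `|a|)%N; have [c ct] : exists c : K, has_degree c t%:Z.
  by exists (Yvar ^+ t); exact: has_degreeYX.
have cgN : mx_le (c *: val g) (t%:Z + N).
  by move=> i j; rewrite mxE; apply: degree_le_mul => //; case: ct.
pose P : 'M[{poly F}]_2 :=
  \matrix_(i, j) \poly_(m < `|t%:Z + N|.+1) coef ((c *: val g) i j) m%:Z.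
have cgP : mx_le (c *: val g - poly_mx P) (- 1).
  move=> i j; have -> : (c *: val g - poly_mx P) i j = (c *: val g) i j -
      laurent_poly (\poly_(m < `|t%:Z + N|.+1) coef ((c *: val g) i j) m%:Z).
    by rewrite [LHS]mxE; congr (_ + _); rewrite !mxE.
  move=> [m|m] // _; rewrite /= coef_poly; case: ltnP => [_|tm].
    by rewrite subrr.
  by rewrite subr0; apply: cgN; move: tm; lia.
have c0 : c != 0 by exact: has_degree_neq0 ct.
pose u := c^-1 *: poly_mx P *m invmx (val g).
have u1 : mx_le (u - 1%:M) (- (k%:Z + 1)).
  have -> : u - 1%:M = - (c^-1 *: ((c *: val g - poly_mx P) *m invmx (val g))).
    rewrite /u mulmxBl scalerBr -!scalemxAl scalerA mulVf // scale1r.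
    by rewrite mulmxV ?(valP g) // opprB.
  apply: mx_leN => i j; rewrite mxE.
  apply: degree_leW (degree_le_mul (has_degreeV ct).1 (mx_leM cgP ga i j)).
  by rewrite /t; lia.
have uU : u \in unitmx by apply: near1_GL2; apply: mx_leW u1; lia.
have PU : poly_mx P \in unitmx.
  have -> : poly_mx P = c *: (u *m val g).
    rewrite /u -mulmxA mulVmx ?(valP g) // mulmx1.
    by rewrite scalerA divff // scale1r.
  rewrite unitmxZ; last by rewrite unitfE.
  by rewrite unitmx_mul; apply/andP; split; [exact: uU|exact: (valP g)].
exists P, (toGL2 PU); split=> //; apply: cong_ball_sym.
exists (toGL2 uU); first exact: u1.
apply/class_of_eqP/asboolP; exists c, 1%:M; split; rewrite ?unitmx1 //.
rewrite map_mx1 mulmx1 /= -/g -mulmxA mulVmx ?(valP g) // mulmx1.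
by rewrite scalerA divff // scale1r.
Qed.

(** There are only countably many matrices with polynomial entries. *)
Lemma X_countable_base : exists b : nat -> set X,
  (forall i, compact_clopen (b i)) /\
  (forall U : set X, open U -> forall x, U x -> exists i, b i x /\ b i `<=` U).
Proof.
pose cl (P : 'M[{poly F}]_2) : X := xget point [set class_of h | h in
  [set h : GL2 F | val h = poly_mx P]].
pose b i := if @unpickle (nat * 'M[{poly F}]_2)%type i is Some kP
  then cong_ball kP.1 (cl kP.2) else set0.
exists b; split=> [i|U oU x Ux].
  rewrite /b; case: unpickle => [kP|]; first exact: cong_ball_compact_clopen.
  exact: compact_clopen0.
have [k kU] := open_cong_ball oU Ux.
have [P [h [hP hx]]] := poly_class_dense k x.
exists (pickle (k, P)); rewrite /b pickleK /=.
have -> : cl P = class_of h.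
  rewrite /cl; apply: xget_unique => [|_ [h' h'P <-]]; first by exists h.
  by congr class_of; apply: val_inj; rewrite h'P.
split; first exact: hx.
by move=> y hy; apply: kU; exact: cong_ball_trans (cong_ball_sym hx) hy.
Qed.

Lemma unit_poly_det (w : 'M[{poly F}]_2) : w \in unitmx ->
  has_degree (laurent_poly (\det w)) 0.
Proof.
rewrite unitmxE poly_unitE => /andP[/eqP s1 _].
by have := @has_degree_poly F (\det w); rewrite -size_poly_gt0 s1; exact.
Qed.

(** A matrix of [K^* GL_2(F[Y])] close to the identity is scalar: polynomials of
    negative degree vanish. *)
Lemma near1_scalar (c : K) (w : 'M[{poly F}]_2) : w \in unitmx ->
  mx_le (c *: poly_mx w - 1%:M) (- 1) -> exists c' : K, c *: poly_mx w = c'%:M.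
Proof.
move=> wU w1; have wd := near1_unitmx w1.
have wentry i j : degree_le (c * laurent_poly (w i j) - (i == j)%:R) (- 1).
  by have := w1 i j; rewrite !mxE.
have d0 := unit_poly_det wU.
have c0 : c != 0.
  apply: contraTneq (has_degree_neq0 wd) => ->; rewrite scale0r.
  by rewrite det0 eqxx.
have [d cd] := has_degree_ex c0.
have dE : d = 0.
  have := has_degreeM (has_degreeM cd cd) d0.
  have -> : c * c * laurent_poly (\det w) = \det (c *: poly_mx w).
    by rewrite detZ det_map_mx expr2.
  by move=> /has_degree_uniq/(_ wd); lia.
rewrite dE in cd.
have off i j : i != j -> w i j = 0.
  move=> ij; apply/eqP; apply: contraT => wij.
  have := wentry i j; rewrite (negPf ij) subr0 => cw.
  have : degree_le (laurent_poly (w i j)) (- 1).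
    by apply: (degree_le_divl cd); rewrite add0r.
  by move=> /(degree_le_poly_ge0 wij).
have wi0 i : degree_le (laurent_poly (w i i)) 0.
  apply: (degree_le_divl cd); rewrite addr0.
  have := wentry i i; rewrite eqxx => /(has_degree_near (@has_degree1 F)) cw.
  by case: cw.
have wiC i : w i i = ((w i i)`_0)%:P.
  by apply/polyP => -[|k]; rewrite coefC //; exact: (wi0 i (Posz k.+1)).
have ciw i : coef c 0 * (w i i)`_0 = 1.
  have /(_ 0 isT) := wentry i i; rewrite eqxx.
  have := coef_mul_top cd.1 (wi0 i); rewrite addr0 /= => -> /eqP.
  by rewrite subr_eq0 => /eqP.
exists (c * laurent_poly (w 0 0)); apply/matrixP => i j; rewrite !mxE.
have [<-|ij] := eqVneq i j; last by rewrite off // raddf0 mulr0 mulr0n.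
rewrite mulr1n wiC [w 0 0]wiC; congr (c * laurent_poly _%:P).
by apply: (mulfI cd.2); rewrite !ciw.
Qed.

Lemma degree_le_all (f : K) : (forall k : nat, degree_le f (- k%:Z)) -> f = 0.
Proof. by move=> f0; apply: laurentP => n; apply: (f0 (`|n| + 1)%N); lia. Qed.

(** If [y = u_k x] for a sequence [u_k] tending to [1], two far terms of the
    sequence differ by a small element of the stabilizer of [x], which is scalar
    by discreteness; hence a single [u_l] is scalar. *)
Lemma cong_ball_cap x y : (forall k, cong_ball k x y) -> x = y.
Proof.
rewrite -[x]class_of_repr -[y]class_of_repr.
move: (repr x) (repr y) => g h xy.
have uP k : exists2 u, cong k u & exists (c : K) (w : 'M[{poly F}]_2),
    [/\ c != 0, w \in unitmx & val h = c *: (val u *m val g *m poly_mx w)].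
  have [u uk] := xy k; rewrite GL2_act_class_of => /class_of_eqP/asboolP.
  by move=> [c [w [c0 wU hE]]]; exists u => //; exists c, w.
have [l lP] := cong_conj (GL2_inv g) 0.
have [u ul [c [w [c0 wU hE]]]] := uP l.
have key k : (l <= k)%N -> exists2 u', cong k u' & exists2 s,
    degree_le s 0 & val u = s *: val u'.
  move=> lk; have [u' uk [c' [w' [c'0 w'U hE']]]] := uP k.
  exists u' => //; pose v := GL2_mul (GL2_inv u') u.
  have vl : cong l v by apply: congM => //; apply: congV; exact: congW uk.
  have vE : invmx (val g) *m val v *m val g =
      (c^-1 * c') *: poly_mx (w' *m invmx w).
    have wwV : poly_mx w *m poly_mx (invmx w) = 1%:M.
      by rewrite -map_mxM mulmxV // map_mx1.
    have ugE : val u *m val g = c^-1 *: (val h *m poly_mx (invmx w)).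
      by rewrite hE -scalemxAl scalerA mulVf // scale1r -mulmxA wwV mulmx1.
    have -> : invmx (val g) *m val v *m val g =
        invmx (val g) *m (invmx (val u') *m (val u *m val g)) by rewrite !mulmxA.
    rewrite ugE hE' -scalemxAl scalerA -!scalemxAr; congr (_ *: _).
    rewrite -!mulmxA mulKmx ?(valP u') // mulKmx ?(valP g) //.
    by rewrite [RHS]map_mxM.
  have := lP v vl; rewrite /cong /= invmxK vE add0r.
  have wwU : w' *m invmx w \in unitmx by rewrite unitmx_mul w'U unitmx_inv.
  move=> /(near1_scalar wwU)[s sE]; rewrite sE in vE.
  have vs : val v = s%:M.
    have -> : val v = val g *m (invmx (val g) *m val v *m val g) *m invmx (val g).
      by rewrite -!mulmxA mulmxV ?(valP g) // mulmx1 mulmxA mulmxV ?(valP g) // mul1mx.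
    by rewrite vE scalar_mxC -mulmxA mulmxV ?(valP g) // mulmx1.
  exists s; first by have := cong_le0 vl 0 0; rewrite vs mxE eqxx.
  rewrite -mul_mx_scalar -vs /= mulmxA mulmxV ?(valP u') // mul1mx //.
have uscal : val u = (val u 0 0)%:M.
  apply/matrixP => i j; apply/eqP; rewrite -subr_eq0; apply/eqP.
  apply: degree_le_all => k; have [u' uk [s s0 ->]] := key (k + l)%N (leq_addl _ _).
  have -> : (s *: val u') i j - ((s *: val u') 0 0)%:M i j =
      s * ((val u' - 1%:M) i j - ((val u' - 1%:M) 0 0)%:M i j).
    by rewrite !mxE /= mulr1n; case: (i == j); rewrite ?mulr1n ?mulr0n;
      ring.
  suff D : degree_le ((val u' - 1%:M) i j - ((val u' - 1%:M) 0 0)%:M i j) (- k%:Z).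
    by have := degree_le_mul s0 D; rewrite add0r.
  apply: degree_leB; first by apply: degree_leW (uk i j); lia.
  rewrite mxE; case: (i == j); rewrite ?mulr0n ?mulr1n //.
  by apply: degree_leW (uk 0 0); lia.
apply/class_of_eqP/asboolP; exists (c * val u 0 0), w; split=> //.
  rewrite mulf_neq0 //; apply: contraTneq (valP u) => u00.
  by rewrite uscal u00 unitmxE det_scalar expr0n unitr0.
by rewrite hE {1}uscal mul_scalar_mx -scalemxAl scalerA.
Qed.

Lemma X_hausdorff : hausdorff_space X.
Proof.
move=> x y xy; apply: cong_ball_cap => k.
have [z [/cong_ball_sym zx yz]] := xy _ _ (nbhs_cong_ball k x) (nbhs_cong_ball k y).
exact: cong_ball_trans (cong_ball_sym zx) (cong_ball_sym yz).
Qed.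

End Topology.

(** * The diagonal action *)

Section Diagonal.
Variable F : finFieldType.
Local Notation K := (laurent F).
Local Notation X := (X_infty F).
Implicit Types (f s : K) (x y : X).

(** The diagonal matrix with entries [f] and [1], except that [f = 0] is replaced
    by [1] to get a total function with values in [GL2]. *)
Definition diag1_mx f : 'M[K]_2 :=
  diag_mx (\row_(j < 2) if j == 0 then (if f == 0 then 1 else f) else 1).

Lemma diag1_mx_unit f : diag1_mx f \in unitmx.
Proof.
rewrite unitmxE unitfE /diag1_mx det_diag big_ord_recl big_ord1 !mxE /= mulr1.
by case: (eqVneq f 0) => [_|]; rewrite ?oner_eq0.
Qed.

Lemma diag1_mxE f i j : f != 0 ->
  diag1_mx f i j = (if i == 0 then f else 1) *+ (i == j).
Proof. by move=> f0; rewrite !mxE (negPf f0); case: eqVneq => [->|]. Qed.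

Lemma det_diag1_mx f : f != 0 -> \det (diag1_mx f) = f.
Proof. by move=> f0; rewrite det2E !diag1_mxE //= !mulr1n mulr0n mul0r subr0 mulr1. Qed.

Definition diag1 f : GL2 F := toGL2 (diag1_mx_unit f).

Lemma diag1M f g : f != 0 -> g != 0 -> diag1 (f * g) = GL2_mul (diag1 f) (diag1 g).
Proof.
move=> f0 g0; apply: val_inj => /=; rewrite /diag1_mx mulmx_diag.
congr diag_mx; apply/rowP => j; rewrite !mxE (negPf f0) (negPf g0).
by rewrite mulf_eq0 (negPf f0) (negPf g0) /=; case: (j == 0); rewrite ?mulr1.
Qed.

Lemma diag1_1 : diag1 1 = GL2_one F.
Proof.
apply: val_inj => /=; apply/matrixP => i j; rewrite diag1_mxE ?oner_neq0 // mxE.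
by case: (i == 0).
Qed.

Lemma diag1_A f : A_infty (diag1 f).
Proof. exact: diag_mx_is_diag. Qed.

Lemma diag1_cong k f : degree_le (f - 1) (- (k%:Z + 1)) -> cong k (diag1 f).
Proof.
move=> f1; have f0 : f != 0.
  by apply: has_degree_neq0 (has_degree_near (has_degree1 _) f1 _); lia.
move=> i j; have -> : (val (diag1 f) - 1%:M) i j = diag1_mx f i j - (i == j)%:R.
  by rewrite !mxE.
rewrite diag1_mxE //.
case: (i == j); rewrite ?mulr0n ?subrr ?mulr1n //.
by case: (i == 0); rewrite ?subrr.
Qed.

Definition torus_act f x := GL2_act (diag1 f) x.

Lemma torus_act1 x : torus_act 1 x = x.
Proof. by rewrite /torus_act diag1_1 GL2_act1. Qed.

Lemma torus_actM f g x :
  f != 0 -> g != 0 -> torus_act (f * g) x = torus_act f (torus_act g x).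
Proof. by move=> f0 g0; rewrite /torus_act (diag1M f0 g0) GL2_actM. Qed.

Lemma torus_actK f x : f != 0 -> torus_act f^-1 (torus_act f x) = x.
Proof.
move=> f0; have i0 : f^-1 != 0 by rewrite invr_eq0.
by rewrite -(torus_actM _ i0 f0) (mulVf f0) torus_act1.
Qed.

(** Up to a scalar, a diagonal matrix has lower right entry [1]. *)
Lemma A_torus_act (a : GL2 F) : A_infty a -> exists2 f, f != 0 &
  forall x, GL2_act a x = torus_act f x.
Proof.
move=> /is_diag_mxP ad; have detE := det2E (val a).
rewrite (ad 0 1) // mul0r subr0 in detE.
have : \det (val a) != 0 by rewrite -unitfE -unitmxE; exact: (valP a).
rewrite detE mulf_eq0 negb_or => /andP[a0 a1].
have f0 : val a 0 0 / val a 1 1 != 0 by rewrite mulf_neq0 ?invr_eq0.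
set f := val a 0 0 / val a 1 1 in f0 *; exists f => // x.
have dgE : diag1_mx f = (val a 1 1)^-1 *: val a.
  apply/matrixP => i j; rewrite diag1_mxE // mxE.
  have [<-|ij] := eqVneq i j; last by rewrite (ad _ _ ij) mulr0n mulr0.
  rewrite mulr1n; case: (eqVneq i 0) => [->|i0]; first by rewrite mulrC.
  have -> : i = 1 by apply/val_inj; case: i i0 => [[|[|]]].
  by rewrite mulVf.
rewrite -[x]class_of_repr /torus_act !GL2_act_class_of.
apply/class_of_eqP/asboolP; exists (val a 1 1)^-1, 1%:M; split.
- by rewrite invr_eq0.
- exact: unitmx1.
move: (repr x) => g; have -> : val (GL2_mul (diag1 f) g) = diag1_mx f *m val g by [].
have -> : val (GL2_mul a g) = val a *m val g by [].
by rewrite map_mx1 mulmx1 dgE scalemxAl.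
Qed.

Lemma A_orbitE x : A_orbit x = [set torus_act f x | f in [set f | f != 0]].
Proof.
apply/seteqP; split=> _ [a aA <-].
  by have [f f0 fE] := A_torus_act aA; exists f.
by exists (diag1 a) => //; exact: diag1_A.
Qed.

Lemma torus_act_ball k f x :
  degree_le (f - 1) (- (k%:Z + 1)) -> cong_ball k x (torus_act f x).
Proof. by move=> f1; exists (diag1 f) => //; exact: diag1_cong. Qed.

Lemma Yvar_neq0 : (Yvar : K) != 0.
Proof. exact: has_degree_neq0 (@has_degreeY F). Qed.

Lemma unit_decomp f d : has_degree f d ->
  exists2 s, has_degree s 0 & f = Yvar ^ d * s.
Proof.
move=> fd; have Y0 := Yvar_neq0.
exists ((Yvar ^ d)^-1 * f); last by rewrite mulVKf ?expfz_neq0.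
by have := has_degreeM (has_degreeV (has_degreeYz F d)) fd; rewrite addNr.
Qed.

(** * Truncated units *)

Definition trunc_coefs k f : {ffun 'I_k.+1 -> F} := [ffun i : 'I_k.+1 =>
  coef f (- i%:Z)].

Lemma trunc_unit_subproof k (c : {ffun 'I_k.+1 -> F}) :
  `[< exists N : int, forall n, N < n ->
      (if (n <= 0) && (`|n| <= k)%N then c (inord `|n|) else 0) = 0 >].
Proof. by apply/asboolP; exists 0 => n n0; rewrite leNgt n0. Qed.

Definition trunc_unit k c : K := Laurent (@trunc_unit_subproof k c).

Lemma trunc_unitK k : cancel (@trunc_unit k) (@trunc_coefs k).
Proof.
move=> c; apply/ffunP => i; rewrite ffunE /=.
by rewrite oppr_le0 abszN absz_nat -ltnS ltn_ord inord_val.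
Qed.

Lemma trunc_unit_deg k c : degree_le (@trunc_unit k c) 0.
Proof. by move=> n n0; rewrite /= leNgt n0. Qed.

Lemma trunc_unit_coef0 k c : coef (@trunc_unit k c) 0 = c ord0.
Proof. by rewrite /=; congr (c _); apply/val_inj; rewrite /= inordK. Qed.

Lemma trunc_coefsP k f : degree_le f 0 ->
  degree_le (f - trunc_unit (trunc_coefs k f)) (- (k%:Z + 1)).
Proof.
move=> f0 n kn; rewrite /=; have [n0|n0] := lerP n 0; last by rewrite f0 ?subrr.
have nk : (`|n| <= k)%N by move: kn; lia.
rewrite /= nk ffunE inordK ?ltnS //; rewrite (_ : - _ = n) ?subrr //.
by move: n0; lia.
Qed.

Lemma trunc_coefs_inj k (c c' : {ffun 'I_k.+1 -> F}) s : has_degree s 0 ->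
  trunc_coefs k (s * trunc_unit c) = trunc_coefs k (s * trunc_unit c') -> c = c'.
Proof.
move=> s0 ccE; rewrite -[c]trunc_unitK -[c']trunc_unitK.
have sc0 c1 : degree_le (s * @trunc_unit k c1) 0.
  by rewrite -[0]addr0; exact: degree_le_mul s0.1 (@trunc_unit_deg _ _).
have := degree_leB (@trunc_coefsP k _ (sc0 c)) (@trunc_coefsP k _ (sc0 c')).
rewrite ccE opprB addrA subrK -mulrBr -[X in degree_le _ X]add0r.
move=> /(degree_le_divl s0) D.
apply/ffunP => i; rewrite !ffunE; apply/eqP; rewrite -subr_eq0; apply/eqP.
by apply: D; have := ltn_ord i; lia.
Qed.

End Diagonal.

(** * Invariant measures on compact orbits *)

Lemma indic_iff (R : pzRingType) (T : Type) (A C : set T) y z :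
  (A y <-> C z) -> \1_A y = \1_C z :> R.
Proof.
move=> AC; rewrite !indicE; congr ((nat_of_bool _)%:R).
by apply/idP/idP => /set_mem /AC /mem_set.
Qed.

Section OrbitAverage.
Variables (F : finFieldType) (R : realType).
Local Notation K := (laurent F).
Local Notation X := (X_infty F).
Variables (x : X) (P : nat).
Hypothesis P0 : (0 < P)%N.

Definition trunc_seq k := {ffun 'I_k.+1 -> F}.

(** As [t] and the [c] with [c ord0 != 0] vary, these elements represent the series of
    degree [t] modulo the series congruent to [1] up to degree [- k]. *)
Definition box_elt k (t : nat) (c : trunc_seq k) : K := Yvar ^+ t * trunc_unit c.

Definition visits k (C : set X) t : R :=
  \sum_(c : trunc_seq k | c ord0 != 0) \1_C (torus_act (box_elt t c) x).

Definition nunits k : R := \sum_(c : trunc_seq k | c ord0 != 0) 1.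

(** The average over a box of the diagonal group. The number of degrees in the box is a
    multiple of [P] so that, on an orbit of period [P], all residues modulo [P] have
    exactly the same weight. *)
Definition box_avg k (C : set X) : R :=
  (\sum_(t < k.+1 * P) visits k C t) / ((k.+1 * P)%:R * nunits k).

Lemma trunc_unit_unit k (c : trunc_seq k) : c ord0 != 0 -> has_degree (trunc_unit c) 0.
Proof. by move=> c0; split; [exact: trunc_unit_deg|rewrite trunc_unit_coef0]. Qed.

Lemma box_elt_degree k t (c : trunc_seq k) :
  c ord0 != 0 -> has_degree (box_elt t c) t%:Z.
Proof.
move=> /trunc_unit_unit c0.
by have := has_degreeM (has_degreeYX F t) c0; rewrite addr0.
Qed.

Lemma nunits_gt0 k : 0 < nunits k.
Proof.
rewrite /nunits (bigD1 [ffun=> 1]) /=; last by rewrite ffunE oner_neq0.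
by rewrite ltr_wpDr // sumr_ge0.
Qed.

Lemma box_card_gt0 k : 0 < (k.+1 * P)%:R * nunits k.
Proof. by rewrite mulr_gt0 ?nunits_gt0 // ltr0n muln_gt0 P0. Qed.

Lemma visits_ge0 k C t : 0 <= visits k C t.
Proof. by apply: sumr_ge0 => c _; rewrite indicE. Qed.

Lemma visits_le k C t : visits k C t <= nunits k.
Proof. by apply: ler_sum => c _; rewrite indicE; case: (_ \in _). Qed.

Lemma box_avg_ge0 k C : 0 <= box_avg k C.
Proof.
apply: divr_ge0; last exact: ltW (box_card_gt0 k).
by apply: sumr_ge0 => t _; exact: visits_ge0.
Qed.

Lemma box_avg_le k C (r : R) :
  \sum_(t < k.+1 * P) visits k C t <= r * ((k.+1 * P)%:R * nunits k) ->
    box_avg k C <= r.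
Proof. by rewrite /box_avg ler_pdivrMr ?box_card_gt0. Qed.

Lemma box_avg01 k C : 0 <= box_avg k C <= 1.
Proof.
rewrite box_avg_ge0 /=; apply: box_avg_le; rewrite mul1r.
apply: (@le_trans _ _ (\sum_(t < k.+1 * P) nunits k)).
  by apply: ler_sum => t _; exact: visits_le.
by rewrite sumr_const card_ord mulr_natl.
Qed.

Lemma box_avgU k A C :
  A `&` C = set0 -> box_avg k (A `|` C) = box_avg k A + box_avg k C.
Proof.
move=> AC; rewrite /box_avg -mulrDl -big_split; congr (_ / _).
apply: eq_bigr => t _; rewrite /visits -big_split; apply: eq_bigr => c _.
rewrite !indicE in_setU; set y := torus_act _ _.
case: (boolP (y \in A)) => yA; case: (boolP (y \in C)) => yC;
  rewrite /= ?addr0 ?add0r //.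
have : (A `&` C) y by split; exact: set_mem.
by rewrite AC.
Qed.

Lemma box_avg_eq k C C' :
  (forall t, visits k C t = visits k C' t) -> box_avg k C = box_avg k C'.
Proof. by move=> E; rewrite /box_avg; congr (_ / _); apply: eq_bigr => t _;
  exact: E. Qed.

Lemma box_avg_orbit0 k C : A_orbit x `&` C = set0 -> box_avg k C = 0.
Proof.
move=> OC; rewrite /box_avg big1 ?mul0r // => t _; rewrite /visits big1 // => c c0.
rewrite indicE memNset // => Cx.
have : (A_orbit x `&` C) (torus_act (box_elt t c) x).
  split=> //; rewrite A_orbitE; exists (box_elt t c) => //.
  exact: has_degree_neq0 (box_elt_degree t c0).
by rewrite OC.
Qed.

Lemma box_avg_orbit1 k C : A_orbit x `<=` C -> box_avg k C = 1.
Proof.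
move=> OC; rewrite /box_avg.
have -> : \sum_(t < k.+1 * P) visits k C t = (k.+1 * P)%:R * nunits k.
  transitivity (\sum_(t < k.+1 * P) nunits k); last first.
    by rewrite sumr_const card_ord mulr_natl.
  apply: eq_bigr => t _; apply: eq_bigr => c c0.
  rewrite indicE mem_set //; apply: OC; rewrite A_orbitE; exists (box_elt t c) => //.
  exact: has_degree_neq0 (box_elt_degree t c0).
by rewrite divff // gt_eqF ?box_card_gt0.
Qed.

Definition stable k (C : set X) := forall y z, cong_ball k y z -> C y -> C z.

(** Multiplication by a unit permutes the truncated units, up to an error absorbed
    by [stable k C]. *)
Lemma box_avg_unit k C s : has_degree s 0 -> stable k C ->
  box_avg k (torus_act s @^-1` C) = box_avg k C.
Proof.
move=> s0 Ck; apply: box_avg_eq => t.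
rewrite /visits [RHS](reindex_inj (h := fun c => trunc_coefs k (s * trunc_unit c))).
  have coef0E c : trunc_coefs k (s * trunc_unit c) ord0 = coef s 0 * c ord0.
    rewrite ffunE oppr0 -[X in coef _ X]addr0 coef_mul_top ?trunc_unit_coef0 //.
      by case: s0.
    exact: trunc_unit_deg.
  apply: eq_big => [c|c c0].
    by rewrite coef0E mulf_eq0 negb_or; case: s0 => _ ->.
  pose w := trunc_unit (trunc_coefs k (s * trunc_unit c)).
  have w0 : has_degree w 0.
    by apply: trunc_unit_unit; rewrite coef0E mulf_neq0 //; case: s0.
  have sc0 : degree_le (s * trunc_unit c) 0.
    by have := degree_le_mul s0.1 (trunc_unit_deg c); rewrite addr0.
  pose e := s * trunc_unit c / w.
  have e1 : degree_le (e - 1) (- (k%:Z + 1)).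
    have -> : e - 1 = (s * trunc_unit c - w) * w^-1.
      by rewrite mulrBl mulfV // (has_degree_neq0 w0).
    have := degree_le_mul (@trunc_coefsP _ k _ sc0) (has_degreeV w0).1.
    by rewrite oppr0 addr0.
  have e0 : e != 0.
    by apply: has_degree_neq0 (has_degree_near (has_degree1 _) e1 _); lia.
  have w'0 := has_degree_neq0 w0; have s'0 := has_degree_neq0 s0.
  have r0 := has_degree_neq0 (box_elt_degree t c0).
  have Yw0 : Yvar ^+ t * w != 0 by rewrite mulf_neq0 ?expf_neq0 ?Yvar_neq0.
  have E : torus_act s (torus_act (box_elt t c) x) =
    torus_act e (torus_act (Yvar ^+ t * w) x).
    rewrite -(torus_actM _ s'0 r0) -(torus_actM _ e0 Yw0); congr (torus_act _ x).
    by rewrite /box_elt /e [RHS]mulrCA divfK // mulrCA.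
  have bE := torus_act_ball (torus_act (Yvar ^+ t * w) x) e1; rewrite -E in bE.
  by apply: indic_iff; split=> Cy; [exact: Ck (cong_ball_sym bE) Cy|exact: Ck bE Cy].
by move=> c c'; exact: trunc_coefs_inj.
Qed.

(** A telescoping sum leaves two boundary terms out of [k.+1 * P]. *)
Lemma box_avg_Y k C : `|box_avg k (torus_act Yvar @^-1` C) - box_avg k C| <= k.+1%:R^-1.
Proof.
have visitsY t : visits k (torus_act Yvar @^-1` C) t = visits k C t.+1.
  apply: eq_bigr => c c0; apply: indic_iff.
  have r0 := has_degree_neq0 (box_elt_degree t c0).
  have E : torus_act Yvar (torus_act (box_elt t c) x) = torus_act (box_elt t.+1 c) x.
    by rewrite -(torus_actM _ (Yvar_neq0 F) r0) /box_elt mulrA exprS.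
  by rewrite -E; exact: iff_refl.
rewrite /box_avg -mulrBl; set n := (k.+1 * P)%N.
have -> : \sum_(t < n) visits k (torus_act Yvar @^-1` C) t - \sum_(t < n) visits k C t =
    visits k C n - visits k C 0.
  have E : \sum_(t < n) visits k (torus_act Yvar @^-1` C) t =
    \sum_(t < n) visits k C t.+1.
    by apply: eq_bigr => t _; exact: visitsY.
  apply: etrans (congr1 (fun u => u - \sum_(t < n) visits k C t) E) _.
  by rewrite -sumrB -(big_mkord xpredT (fun t => visits k C t.+1 - visits k C t))
    telescope_sumr.
have nP : (k.+1%:R : R) <= n%:R by rewrite ler_nat leq_pmulr.
have n0 : 0 < n%:R :> R by apply: lt_le_trans nP; rewrite ltr0n.
rewrite normrM [`|_^-1|]ger0_norm ?invr_ge0 ?(ltW (box_card_gt0 k)) //.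
rewrite ler_pdivrMr ?box_card_gt0 // mulrA.
apply: (@le_trans _ _ (nunits k)); last first.
  by rewrite ler_peMl ?(ltW (nunits_gt0 k)) // mulrC ler_pdivlMr // mul1r.
have := visits_ge0 k C n; have := visits_ge0 k C 0.
have := visits_le k C n; have := visits_le k C 0.
move: (visits k C n) (visits k C 0) (nunits k) => u v w.
by rewrite ler_norml; lra.
Qed.

End OrbitAverage.

Section OrbitMeasure.
Variables (F : finFieldType) (R : realType).
Local Notation K := (laurent F).
Local Notation X := (X_infty F).
Local Notation B := (g_sigma_algebraType (@open X)).

Lemma measurable_compact (A : set X) : compact A -> measurable (A : set B).
Proof.
move=> cA; have kA : closed A := compact_closed (@X_hausdorff F) cA.
rewrite -[A]setCK; apply: measurableC; apply: sub_gen_smallest.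
by rewrite openC.
Qed.

Lemma measurable_act (a : GL2 F) : measurable_fun setT (GL2_act a : B -> B).
Proof.
apply: (@measurability _ _ B B setT (GL2_act a : B -> B) (@open X) erefl).
move=> _ [U oU <-].
rewrite setTI; apply: sub_gen_smallest.
by have /continuousP := @GL2_act_continuous F a; apply.
Qed.

Lemma compact_clopen_act (a : GL2 F) (C : set X) :
  compact_clopen C -> compact_clopen (GL2_act a @^-1` C).
Proof.
move=> [cC oC kC]; have ca := @GL2_act_continuous F a; split.
- have -> : GL2_act a @^-1` C = GL2_act (GL2_inv a) @` C.
    apply/seteqP; split=> [y Cy|_ [z Cz <-]].
      by exists (GL2_act a y); [exact: Cy|exact: GL2_actK].
    by rewrite /preimage /mkset GL2_actKV.
  apply: continuous_compact cC; apply: continuous_subspaceT.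
  exact: GL2_act_continuous.
- by apply: open_comp oC => y _; exact: ca.
- by apply: closed_comp kC => y _; exact: ca.
Qed.

(** A compact clopen set is a finite union of small balls. *)
Lemma compact_clopen_stable (C : set X) : compact_clopen C ->
  exists N, forall k, (N <= k)%N -> stable k C.
Proof.
move=> [/compact_near_coveringP cC oC _].
pose Q k y := cong_ball k y `<=` C.
have [y Cy|N _ NQ] := cC nat \oo Q _; last first.
  by exists N => k Nk y z yz Cy; exact: NQ k Nk y Cy z yz.
have [k kC] := open_cong_ball oC Cy; exists (cong_ball k y, [set l | (k <= l)%N]).
  by split; [exact: nbhs_cong_ball|exists k].
move=> [z l] /= [yz kl] w zw; apply: kC; apply: cong_ball_trans yz _.
exact: cong_ball_subset kl _ zw.
Qed.

Variables (x : X) (P : nat).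
Hypothesis P0 : (0 < P)%N.
Hypothesis x_compact : compact (A_orbit x).

(** The measure is the limit of the averages [box_avg] along an ultrafilter. The boxes
    are nearly invariant by [Y] and, on a given compact clopen set, eventually
    invariant by the series of degree [0]; these generate the action. A bound for all
    averages passes to the limit, and gives the estimate of the mass in the cusp. *)
Theorem orbit_measure_exists : exists mu : probability B R, orbit_measure x mu /\
  forall (C : set X) (r : R), compact_clopen C ->
    (forall k, box_avg R x P k C <= r) -> (mu C <= r%:E)%E.
Proof.
have [b [b_clopen b_base]] := @X_countable_base F.
have [G [GU Goo]] := @ultraFilterLemma nat \oo _.
have [theta thetaP] := @vague_limit R X b b_clopen b_base G
  (fun k C => box_avg R x P k C) GU (fun k C => box_avg01 R x P0 k C)
  (fun k A C _ _ => @box_avgU F R x P k A C).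
have theta_le C r : compact_clopen C -> (\forall k \near G, box_avg R x P k C <= r) ->
    (theta C <= r%:E)%E.
  move=> cC Cr; have [l -> cl] := thetaP C cC.
  by rewrite lee_fin; exact: (cvgr_to_le cl Cr).
have theta_setT : theta setT = 1%E.
  apply/eqP; rewrite eq_le; apply/andP; split.
    apply: (open_measure_le b_clopen b_base openT) => C cC _.
    apply: (theta_le _ _ cC); apply: nearW => k.
    by have /andP[] := box_avg01 R x P0 k C.
  have [|n On] := compact_open_cover x_compact
    (fun i => let: And3 _ o _ := b_clopen i in o).
    by move=> y _; have [i [biy _]] := b_base _ openT y I; exists i.
  set C := \big[_/_]_(_ < n) _ in On.
  have cC : compact_clopen C.
    rewrite /C; elim: {C On} n => [|n IH].
      by rewrite big_ord0; exact: compact_clopen0.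
    by rewrite big_ord_recr; exact: compact_clopenU.
  have [l thC cl] := thetaP C cC.
  have l1 : l = 1.
    have one k : box_avg R x P k C = 1 by exact: (box_avg_orbit1 R P0 k On).
    have c1 : box_avg R x P k C @[k --> G] --> (1 : R).
      by under eq_fun do rewrite one; exact: cvg_cst.
    exact: cvg_unique cl c1.
  rewrite -l1 -thC; apply: le_measure; rewrite ?inE //.
  exact: compact_clopen_measurable.
have [mu muE] := probability_of_measure theta_setT.
exists mu; split; last first.
  by move=> C r cC Cr; rewrite muE; apply: (theta_le _ _ cC); exact: nearW.
have closedO : closed (A_orbit x) by exact: compact_closed (@X_hausdorff F) x_compact.
have mO : measurable (A_orbit x : set B) by exact: measurable_compact.
split.
  have thO : theta (~` A_orbit x) = 0%E.
    apply/eqP; rewrite eq_le measure_ge0 andbT.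
    apply: (open_measure_le b_clopen b_base); first by rewrite openC.
    move=> C cC CO; apply: (theta_le _ _ cC); apply: nearW => k.
    rewrite box_avg_orbit0 //; apply/seteqP; split=> // y [Oy /CO]; exact.
  rewrite muE -theta_setT -(setUv (A_orbit x)) measureU //; last by rewrite setICr.
    by rewrite -[LHS]adde0; congr (_ + _)%E; exact: esym thO.
  exact: measurableC.
have H_clopen f : (forall C, compact_clopen C ->
  theta (torus_act f @^-1` C) = theta C) ->
    forall A : set B, measurable A -> theta (torus_act f @^-1` A) = theta A.
  move=> fC; have theta_fin : (theta setT < +oo)%E by rewrite theta_setT ltry.
  pose q := measure_function_pushforward__canonical__measure_function_Measure
    theta (measurable_act (diag1 f)).
  have qC C : compact_clopen C -> theta C = q C by move=> cC; rewrite -fC.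
  move=> A mA.
  by rewrite (clopen_measure_unique b_clopen b_base theta_fin qC mA).
pose H f := forall A : set B, measurable A -> theta (torus_act f @^-1` A) = theta A.
have mact f (A : set B) : measurable A -> measurable (torus_act f @^-1` A : set B).
  by move=> mA; rewrite -[X in measurable X]setTI; exact: measurable_act.
have HM f g : f != 0 -> g != 0 -> H f -> H g -> H (f * g).
  move=> f0 g0 Hf Hg A mA; have E := funext (fun y => congr1 A (torus_actM y f0 g0)).
  rewrite [_ @^-1` _]E; exact: etrans (Hg _ (mact f _ mA)) (Hf _ mA).
have HV f : f != 0 -> H f -> H f^-1.
  move=> f0 Hf A mA; have E := funext (fun y => congr1 A (torus_actK y f0)).
  by apply: etrans (esym (Hf _ (mact f^-1 _ mA))) _; congr (theta _); exact: E.
have Hunit s : has_degree s 0 -> H s.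
  move=> s0; apply: H_clopen => C cC.
  have [l1 -> c1] := thetaP _ (compact_clopen_act (diag1 s) cC).
  have [l2 -> c2] := thetaP _ cC; congr (_%:E).
  apply: (cvg_unique (@Rhausdorff R) _ c2).
  apply: cvg_trans c1; apply: near_eq_cvg; apply: Goo.
  have [N NC] := compact_clopen_stable cC; exists N; first exact: I.
  by move=> k Nk; exact: (box_avg_unit R x P0 s0 (NC k Nk)).
have HY : H Yvar.
  apply: H_clopen => C cC.
  have [l1 -> c1] := thetaP _ (compact_clopen_act (diag1 Yvar) cC).
  have [l2 -> c2] := thetaP _ cC; congr (_%:E); apply/eqP; rewrite -subr_eq0.
  apply/eqP; apply: (cvg_unique (@Rhausdorff R) (cvgB c1 c2)).
  apply/cvgr0Pnorm_le => e e0; apply: Goo.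
  apply: filterS (near_infty_natSinv_lt (PosNum e0)) => k /= /ltW ke.
  by apply: le_trans ke; exact: box_avg_Y.
move=> a A /A_torus_act[f f0 fE] mA; rewrite !muE.
have -> : GL2_act a @^-1` A = torus_act f @^-1` A.
  by apply/seteqP; split=> y; rewrite /preimage /mkset fE.
have [d fd] := has_degree_ex f0; have [s s0 ->] := unit_decomp fd.
have Y0 := Yvar_neq0 F; have HYX n : H (Yvar ^+ n).
  elim: n => [|n IH]; first by rewrite expr0; apply: Hunit; exact: has_degree1.
  by rewrite exprS; apply: HM => //; rewrite expf_neq0.
suff HYd : H (Yvar ^ d).
  exact: (HM _ _ (expfz_neq0 d Y0) (has_degree_neq0 s0) HYd (Hunit _ s0) _ mA).
case: (d) => n; first exact: HYX.
by rewrite NegzE -exprnN; apply: HV; [rewrite expf_neq0|exact: HYX].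
Qed.

End OrbitMeasure.

(** * Periods of compact orbits *)

Section Periods.
Variable F : finFieldType.
Local Notation K := (laurent F).
Local Notation X := (X_infty F).
Local Notation B := (g_sigma_algebraType (@open X)).
Implicit Types (x y : X) (f g : K).

(** The layers of the orbit: compact sets, which the action of an element of degree
    [d] shifts by [d]. *)
Definition layer x (n : int) : set X :=
  [set torus_act f x | f in [set f | has_degree f n]].

Lemma diag1_degree_compact n : compact [set diag1 f | f in [set f :
  K | has_degree f n]].
Proof.
apply: (@GL2_compact _ _ `|n|) => [_ [f [fn fn0] <-]|M MP].
  move=> i j; change (degree_le (diag1_mx f i j) `|n|).
  rewrite diag1_mxE; last exact: has_degree_neq0 (conj fn fn0).
  case: (i == j); last exact: degree_le0.
  rewrite mulr1n; case: (i == 0); first exact: degree_leW (ler_norm _) fn.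
  exact: degree_leW (normr_ge0 _) (@degree_le1 F).
have entry i j (N : int) : exists2 f, has_degree f n &
    forall m, N <= m -> coef (M i j) m = coef (diag1_mx f i j) m.
  have [_ [f fn <-] fM] := MP N; exists f => // m Nm.
  by rewrite -(fM i j m Nm).
have M00 : has_degree (M 0 0) n.
  have [f fn fM] := entry 0 0 n; have f0 := has_degree_neq0 fn.
  rewrite diag1_mxE //= mulr1n in fM; case: fn => fn fn0; split; last by rewrite fM.
  by move=> m nm; rewrite fM ?fn // ltW.
exists (diag1 (M 0 0)); first by exists (M 0 0).
have M0 := has_degree_neq0 M00; apply/matrixP => i j; rewrite [LHS]/= diag1_mxE //.
have Mij (e : K) : (forall f, has_degree f n -> diag1_mx f i j = e) -> e = M i j.
  move=> ee; apply: laurentP => m; have [f fn fM] := entry i j m.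
  by rewrite fM // ee.
have [ij|ij] := eqVneq i j; last first.
  by rewrite mulr0n; apply: Mij => f /has_degree_neq0 f0;
    rewrite diag1_mxE // (negPf ij).
rewrite -{}ij in Mij *; rewrite mulr1n; case: eqVneq => i0; first by rewrite i0.
apply: Mij => f /has_degree_neq0 f0.
by rewrite diag1_mxE // eqxx mulr1n (negPf i0).
Qed.

Lemma layer_compact x n : compact (layer x n).
Proof.
have -> : layer x n = (fun a : GL2 F =>
  GL2_act a x) @` [set diag1 f | f in [set f | has_degree f n]].
  apply/seteqP; split=> [_ [f fn <-]|_ [_ [f fn <-] <-]].
    by exists (diag1 f) => //; exists f.
  by exists f.
apply: (@continuous_compact _ _ (fun a : GL2 F => GL2_act a x));
  last exact: diag1_degree_compact.
by apply: continuous_subspaceT; exact: orbit_map_continuous.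
Qed.

Lemma layer_measurable x n : measurable (layer x n : set B).
Proof. exact: measurable_compact (@layer_compact x n). Qed.

Lemma layer_orbit x d : layer x d `<=` A_orbit x.
Proof.
by move=> _ [g gd <-]; rewrite A_orbitE; exists g => //; exact: has_degree_neq0 gd.
Qed.

Lemma layer_preimage x f d n :
  has_degree f d -> torus_act f @^-1` layer x n = layer x (n - d).
Proof.
move=> fd; have f0 := has_degree_neq0 fd; apply/seteqP; split=> y.
  move=> [g gn gx]; exists (f^-1 * g).
    by have := has_degreeM (has_degreeV fd) gn; rewrite addrC.
  have f0' : f^-1 != 0 by rewrite invr_eq0.
  by rewrite (torus_actM _ f0' (has_degree_neq0 gn)) gx (torus_actK _ f0).
move=> [g gn <-]; exists (f * g).
  by have := has_degreeM fd gn; rewrite addrC subrK.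
exact: (torus_actM _ f0 (has_degree_neq0 gn)).
Qed.

(** Otherwise the layers [layer x n] are pairwise disjoint: they would form an infinite
    countable partition of the orbit into sets of equal measure, which contradicts the
    finite nonzero mass of an invariant probability measure. *)
Theorem compact_orbit_period (R : realType) x : compact (A_orbit x) ->
  exists f d, [/\ (0 < d)%N, has_degree f d%:Z & torus_act f x = x].
Proof.
move=> cO; apply: contrapT => noper.
have [mu [[muO muA] _]] := @orbit_measure_exists F R x 1 isT cO.
have disj (n m : int) : n != m -> layer x n `&` layer x m = set0.
  wlog nm : n m / n < m => [wl nm|_].
    have [lt|lt|E] := ltgtP n m.
    - exact: wl lt nm.
    - by rewrite setIC; apply: wl lt _; rewrite eq_sym.
    - by rewrite E eqxx in nm.
  apply/seteqP; split=> // y [[f fn <-] [g gm gx]]; apply: noper.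
  have f0 := has_degree_neq0 fn; have f0' : f^-1 != 0 by rewrite invr_eq0.
  have E : `|m - n|%N%:Z = - n + m by move: nm; lia.
  exists (f^-1 * g), `|m - n|%N; split; first by move: nm; lia.
    by rewrite E; exact: has_degreeM (has_degreeV fn) gm.
  by rewrite (torus_actM _ f0' (has_degree_neq0 gm)) gx (torus_actK _ f0).
have mu_orb n : mu (layer x n) = mu (layer x 0).
  have := muA (diag1 (Yvar ^ (- n))) (layer x 0) (diag1_A _) (layer_measurable _ _).
  by rewrite -[GL2_act _]/(torus_act _) (layer_preimage _ _ (has_degreeYz F _)) opprK add0r.
(* Infinitely many disjoint sets of mass [r] in a probability space force [r = 0]. *)
have orb0 : mu (layer x 0) = 0%E.
  have mfin : mu (layer x 0) \is a fin_num
    by exact: fin_num_measure (layer_measurable _ _).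
  rewrite -(fineK mfin); congr (_%:E); apply/eqP; rewrite eq_le.
  rewrite fine_ge0 // andbT leNgt; apply/negP => r0; set r := fine _ in r0.
  have tI : trivIset setT (fun n : nat => layer x n : set B).
    by apply/trivIsetP => i j _ _ ij; apply: disj; rewrite eqz_nat.
  pose N := (Num.truncn r^-1).+1.
  have : (\sum_(i < N) mu (layer x i) <= 1)%E.
    rewrite -(@measure_bigsetU _ _ _ mu (fun n : nat => layer x n)) //.
      by apply: probability_le1; apply: bigsetU_measurable => i _;
        exact: layer_measurable.
    by move=> i; exact: layer_measurable.
  under eq_bigr do rewrite mu_orb -(fineK mfin).
  rewrite sumEFin lee_fin sumr_const card_ord -/r; apply/negP; rewrite -ltNge.
  by rewrite -mulr_natl -ltr_pdivrMr // mul1r truncnS_gt.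
have : (mu (A_orbit x) <= 0)%E; last by rewrite muO lee_fin ler10.
pose A n : set B := if @unpickle int n is Some k then layer x k else set0.
have mA n : measurable (A n).
  by rewrite /A; case: unpickle => [k|]; [exact: layer_measurable|exact: measurable0].
have muA0 n : mu (A n) = 0%E.
  by rewrite /A; case: unpickle => [k|]; rewrite ?mu_orb ?orb0 ?measure0.
have OA : A_orbit x = \bigcup_n A n.
  apply/seteqP; split=> y.
    rewrite A_orbitE => -[f f0 <-]; have [d fd] := has_degree_ex f0.
    exists (pickle d); first exact: I.
    by rewrite /A pickleK; exists f.
  move=> [n _]; rewrite /A; case: unpickle => // k.
  exact: layer_orbit.
rewrite OA; apply: le_trans (measure_sigma_subadditive mu _ _ _) _.
- exact: mA.
- exact: (bigcupT_measurable _ mA).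
- exact: subset_refl.
by rewrite le_eqVlt; apply/orP; left; apply/eqP; apply: eseries0 => n _ _; exact: muA0.
Qed.

Variables (y : X) (f : K) (P : nat).
Hypothesis P0 : (0 < P)%N.
Hypothesis fP : has_degree f P%:Z.
Hypothesis fy : torus_act f y = y.

Lemma layer_period n : layer y (n + P%:Z) = layer y n.
Proof.
have f0 := has_degree_neq0 fP; have f0' : f^-1 != 0 by rewrite invr_eq0.
have fyV : torus_act f^-1 y = y by rewrite -{1}fy (torus_actK _ f0).
apply/seteqP; split=> _ [g gn <-]; have g0 := has_degree_neq0 gn.
  exists (g * f^-1); first by have := has_degreeM gn (has_degreeV fP); rewrite addrK.
  by rewrite (torus_actM _ g0 f0') fyV.
exists (g * f); first exact: has_degreeM.
by rewrite (torus_actM _ g0 f0) fy.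
Qed.

Lemma layer_mod (n : int) : layer y n = layer y (n %% P%:Z)%Z.
Proof.
have per (q : nat) m : layer y (m + q%:Z * P%:Z) = layer y m.
  elim: q m => [|q IH] m; first by rewrite mul0r addr0.
  by rewrite intS mulrDl mul1r [P%:Z + _]addrC addrA layer_period IH.
rewrite {1}(divz_eq n P); case: (_ %/ _)%Z => q; first by rewrite addrC per.
rewrite -(per q.+1); congr (layer y _); rewrite NegzE; ring.
Qed.

Lemma period_compact : compact (A_orbit y).
Proof.
have -> : A_orbit y = \big[setU/set0]_(i < P) layer y i.
  rewrite -(bigcup_mkord P (fun i : nat => layer y i)); apply/seteqP.
  split=> [z|z [i _]].
    rewrite A_orbitE => -[g g0 <-]; have [d gd] := has_degree_ex g0.
    have : layer y d (torus_act g y) by exists g.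
    have d0 : 0 <= (d %% P%:Z)%Z by rewrite modz_ge0 // gt_eqF.
    rewrite layer_mod => gy; exists `|(d %% P%:Z)%Z|%N; last by rewrite gez0_abs.
    by rewrite /= -ltz_nat gez0_abs // ltz_pmod.
  exact: layer_orbit.
elim: P => [|n IH]; first by rewrite big_ord0; exact: compact0.
by rewrite big_ord_recr; apply: compactU => //; exact: layer_compact.
Qed.

Lemma sum_mod_le (k l : nat) : (l <= P)%N ->
  (\sum_(0 <= t < k * P) (l <= t %% P) = k * (P - l))%N.
Proof.
move=> lP; elim: k => [|k IH]; first by rewrite big_geq.
rewrite mulSn addnC (@big_cat_nat _ _ _ (k * P)) ?leq_addr //= IH addnC.
rewrite mulSn; congr addn.
rewrite -{1}[(k * P)%N]add0n big_addn addnC addnK.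
rewrite (eq_big_nat _ _ (F2 := fun t => nat_of_bool (l <= t)%N)); last first.
  by move=> t /andP[_ tP]; rewrite addnC modnMDl modn_small.
rewrite (@big_cat_nat _ _ _ l) //= big_nat_cond big1 => [|t]; last first.
  by rewrite andbT => /andP[_ tl]; rewrite leqNgt tl.
rewrite add0n big_nat_cond (eq_bigr (fun=> 1%N)) => [|t]; last first.
  by rewrite andbT => /andP[-> _].
by rewrite -big_nat_cond sum_nat_const_nat muln1.
Qed.

(** The layers are periodic of period [P], so that the elements of the box which bring
    [y] to [C] have degrees whose residue modulo [P] is at least [l]. *)
Lemma box_avg_escape (R : realType) (C W : set X) l k : (l <= P)%N ->
  (forall t : nat, (t < l)%N -> layer y t `<=` W) -> C `&` W = set0 ->
  box_avg R y P k C <= 1 - l%:R / P%:R.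
Proof.
move=> lP lW CW; apply: box_avg_le => //.
have visits0 t : (t %% P < l)%N -> visits R y k C t = 0.
  move=> tl; rewrite /visits big1 // => c c0; rewrite indicE memNset // => Cy.
  have : layer y t (torus_act (box_elt t c) y) by exists (box_elt t c) => //;
    exact: box_elt_degree.
  rewrite layer_mod modz_nat => /(lW _ tl) Wy.
  by have : (C `&` W) (torus_act (box_elt t c) y) by []; rewrite CW.
apply: (@le_trans _ _ (\sum_(t < k.+1 * P) nunits F R k * (l <= t %% P)%N%:R)).
  apply: ler_sum => t _; have [tl|tl] := leqP l (t %% P).
    by rewrite mulr1; exact: visits_le.
  by rewrite visits0 // mulr0.
rewrite -mulr_sumr -natr_sum -(big_mkord xpredT (fun t => nat_of_bool (l <= t %% P)%N)).
rewrite sum_mod_le // natrM natrB //.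
have Pn0 : P%:R != 0 :> R by rewrite pnatr_eq0 -lt0n.
by rewrite [in leRHS]natrM le_eqVlt; apply/orP; left; apply/eqP; field.
Qed.

End Periods.

(** * The cusp *)

Section Cusp.
Variable F : finFieldType.
Local Notation K := (laurent F).
Local Notation X := (X_infty F).
Implicit Types (g h u : GL2 F).

(** [cuspidal N h]: the lattice of [h] has a nonzero vector which is short, by [N],
    relatively to its covolume. The last condition says that the determinant has
    degree at least [2 * D + N]. *)
Definition cuspidal (N : int) h := exists (w : 'cV[{poly F}]_2) (D : int),
  [/\ w != 0, mx_le (val h *m map_mx (@laurent_poly F) w) D &
      ~ degree_le (\det (val h)) (2 * D + N - 1)].

Lemma cuspidalW (N M : int) h : N <= M -> cuspidal M h -> cuspidal N h.
Proof.
move=> NM [w [D [w0 wD hD]]]; exists w, D; split=> // hN; apply: hD.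
by apply: degree_leW hN; lia.
Qed.

Lemma cuspidal_coset N g h : same_coset g h -> cuspidal N h -> cuspidal N g.
Proof.
move=> /asboolP[c [v [c0 vU hE]]] [w [D [w0 wD hD]]].
have [d cd] := has_degree_ex c0; exists (v *m w), (D - d); split.
- apply: contra_neq w0 => vw0.
  by rewrite -[w]mul1mx -(mulVmx vU) -mulmxA vw0 mulmx0.
- move=> i j; apply: (degree_le_divl cd); rewrite addrC subrK.
  by have := wD i j; rewrite hE -scalemxAl mxE -mulmxA -map_mxM.
move=> gD; apply: hD; rewrite hE detZ expr2 det_mulmx det_map_mx.
have := degree_le_mul (degree_le_mul cd.1 cd.1)
  (degree_le_mul gD (unit_poly_det vU).1).
by apply: degree_leW; lia.
Qed.

Lemma cuspidal_cong N g u : cong 0 u -> cuspidal N (GL2_mul u g) -> cuspidal N g.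
Proof.
move=> u0 [w [D [w0 wD hD]]]; have ugE : val (GL2_mul u g) = val u *m val g by [].
rewrite ugE -mulmxA in wD; rewrite ugE det_mulmx in hD.
exists w, D; split=> //.
  have := mx_leM (cong_le0 (congV u0)) wD; rewrite add0r.
  have -> : val (GL2_inv u) = invmx (val u) by [].
  by rewrite mulKmx ?(valP u).
by move=> gD; apply: hD; have := degree_le_mul (cong_det u0).1 gD; rewrite add0r.
Qed.

(** A nonzero vector of polynomials has an entry of nonnegative degree, and [g^-1] is
    bounded, so the vectors of the lattice of [g] cannot be arbitrarily short. *)
Lemma not_cuspidal g : exists N : nat, ~ cuspidal N%:Z g.
Proof.
have [E E0 gE] := mx_leP (invmx (val g)); have [d gd] := degree_leP (\det (val g)).
exists (`|d| + 2 * `|E| + 1)%N => -[w [D [w0 wD hD]]].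
have [i wi] : exists i, w i 0 != 0.
  apply: contrapT => /forallNP w0'; move/eqP: w0; apply; apply/matrixP => i j.
  by rewrite mxE ord1; apply/eqP/negPn/negP/w0'.
have := mx_leM gE wD i 0; rewrite mulKmx ?(valP g) // mxE.
move=> /(degree_le_poly_ge0 wi) ED; apply: hD; apply: degree_leW gd.
by move: ED; lia.
Qed.

Definition cusp (N : int) : set X := [set class_of h | h in cuspidal N].

Lemma cusp_class N h : cusp N (class_of h) -> cuspidal N h.
Proof. by move=> [h' h'N /esym /class_of_eqP hh']; exact: cuspidal_coset h'N. Qed.

(** Being cuspidal is invariant by the open group [cong 0], hence locally constant. *)
Lemma compact_avoids_cusp (C : set X) : compact C ->
  exists N : nat, C `&` cusp N%:Z = set0.
Proof.
move=> /compact_near_coveringP cC; pose Q (N : nat) y := ~ cusp N%:Z y.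
have [y _|N _ NQ] := cC nat \oo Q _; last first.
  exists N; apply/seteqP; split=> // y [Cy yN].
  exact: (NQ N (leqnn N) y Cy).
rewrite -[y]class_of_repr; move: (repr y) => g; have [N gN] := not_cuspidal g.
exists (cong_ball 0 (class_of g), [set M | (N <= M)%N]).
  by split; [exact: nbhs_cong_ball|exists N].
move=> [_ M] /= [[u u0 <-] NM]; rewrite GL2_act_class_of => /cusp_class.
by move=> /(cuspidal_cong u0); apply: contra_not gN; apply: cuspidalW; rewrite lez_nat.
Qed.

End Cusp.

(** * Powers of a unit modulo powers of a prime *)

Section UnitPowers.
Variable F : finFieldType.
Local Notation poly := {poly F}.

Lemma pigeonhole (T : finType) (h : nat -> T) : exists i j, (i < j)%N /\ h i = h j.
Proof.
apply: contrapT => nh; pose h' (i : 'I_#|T|.+1) := h i.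
have /leq_card : injective h'.
  move=> i j hij; apply/val_inj; apply: contrapT => /eqP ij; apply: nh.
  by have [lt|lt|E] := ltngtP i j; [exists i, j|exists j, i|case/eqP: ij].
by rewrite card_ord ltnn.
Qed.

(** There are finitely many matrices modulo [nu]. *)
Lemma unit_order (nu : poly) (u : 'M[poly]_2) : (1 < size nu)%N -> u \in unitmx ->
  exists k N, (0 < k)%N /\ u ^+ k = 1 + nu *: N.
Proof.
move=> nu1 uU.
pose T := {ffun 'I_2 * 'I_2 * 'I_(size nu) -> F}.
pose h k : T := [ffun a : 'I_2 * 'I_2 * 'I_(size nu) =>
  (((u ^+ k) a.1.1 a.1.2) %% nu)`_a.2].
have [i [j [ij hE]]] := pigeonhole h.
have nu0 : nu != 0 by rewrite -size_poly_gt0; exact: ltnW.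
have dvd a b : nu %| (u ^+ j - u ^+ i) a b.
  have -> : (u ^+ j - u ^+ i) a b = (u ^+ j) a b - (u ^+ i) a b by rewrite !mxE.
  rewrite /dvdp modpD modpN subr_eq0; apply/eqP/polyP => l.
  have [ln|nl] := ltnP l (size nu); last first.
    by rewrite !nth_default // (leq_trans _ nl) // ltnW // ltn_modp.
  by have /ffunP/(_ (a, b, Ordinal ln)) := hE; rewrite !ffunE.
have uiU : u ^+ i \is a GRing.unit by exact: unitrX.
pose V := (u ^+ i)^-1.
exists (j - i)%N, (V * (\matrix_(a, b) ((u ^+ j - u ^+ i) a b %/ nu))); split.
  by rewrite subn_gt0.
have -> : nu *: (V * (\matrix_(a, b) ((u ^+ j - u ^+ i) a b %/ nu))) =
    V * (u ^+ j - u ^+ i).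
  rewrite scalerAr; congr (_ * _); apply/matrixP => a b.
  by rewrite 2!mxE mulrC divpK.
rewrite mulrBr mulVr // addrC subrK -{2}(subnKC (ltnW ij)) exprD mulrA mulVr //.
by rewrite mul1r.
Qed.

(** In characteristic [p], raising to the [p]-th power multiplies the exponent of
    the congruence by [p]: units become trivial modulo [nu ^+ n] already at exponents
    linear in [n]. *)
Lemma unit_power (p : nat) (nu : poly) (v N : 'M[poly]_2) : p \in [pchar F] ->
  v = 1 + nu *: N ->
  forall m, exists N', v ^+ (p ^ m) = 1 + nu ^+ (p ^ m) *: N'.
Proof.
move=> pF ->; have pM : p \in [pchar 'M[poly]_2].
  rewrite inE (pcharf_prime pF) /=; apply/eqP/matrixP => i j.
  by rewrite mulmxnE -mulr_natr -polyC_natr (pcharf0 pF) mulr0 mxE.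
elim=> [|m [N' IH]]; first by exists N; rewrite expn0 !expr1.
exists (N' ^+ p); rewrite expnSr !exprM IH.
rewrite -(pFrobenius_autE pM) pFrobenius_autD_comm; last exact: commr_sym (commr1 _).
by rewrite !pFrobenius_autE expr1n exprZn.
Qed.

End UnitPowers.

(** * Edges and walks of the Hecke graph *)

Section Walks.
Variable F : finFieldType.
Local Notation K := (laurent F).
Local Notation X := (X_infty F).
Local Notation poly := {poly F}.
Local Notation iota := (@laurent_poly F).
Implicit Types (g h : GL2 F) (x y : X).

Definition pdeg (p : poly) : nat := (size p).-1.

Lemma pdegM p q : p != 0 -> q != 0 -> pdeg (p * q) = (pdeg p + pdeg q)%N.
Proof.
move=> p0 q0; rewrite /pdeg size_mul //.
move: p0 q0; rewrite -!size_poly_gt0; case: (size p) => // a _.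
by case: (size q) => // b _; rewrite addSn addnS.
Qed.

Lemma pdegX p n : p != 0 -> pdeg (p ^+ n) = (n * pdeg p)%N.
Proof.
move=> p0; elim: n => [|n IH]; first by rewrite expr0 /pdeg size_poly1.
by rewrite exprS pdegM ?expf_neq0 // IH mulSn.
Qed.

Lemma pdeg_unit (p : poly) : p \is a GRing.unit -> pdeg p = 0%N.
Proof. by rewrite poly_unitE => /andP[/eqP s1 _]; rewrite /pdeg s1. Qed.

Lemma pdeg_dvd (p q : poly) : q != 0 -> p %| q -> (pdeg p <= pdeg q)%N.
Proof. by move=> q0 /(dvdp_leq q0) pq; rewrite /pdeg -!subn1 leq_sub2r. Qed.

Lemma poly_mxM (A C : 'M[poly]_2) : poly_mx (A *m C) = poly_mx A *m poly_mx C.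
Proof. exact: map_mxM. Qed.

Lemma poly_mx1 : poly_mx (1%:M : 'M[poly]_2) = 1%:M.
Proof. exact: map_mx1. Qed.

Lemma poly_mx_inj : injective (@poly_mx F).
Proof.
move=> A C AC; apply/matrixP => i j; apply: (@laurent_poly_inj F).
by have /matrixP/(_ i j) := AC; rewrite !mxE.
Qed.

Lemma det_poly_mx (A : 'M[poly]_2) : \det (poly_mx A) = iota (\det A).
Proof. exact: det_map_mx. Qed.

Lemma poly_mx_unit (A : 'M[poly]_2) : \det A != 0 -> poly_mx A \in unitmx.
Proof.
by move=> A0; rewrite unitmxE unitfE det_poly_mx raddf_eq0 //; exact: laurent_poly_inj.
Qed.

Lemma unit_det_neq0 (v : 'M[poly]_2) : v \in unitmx -> \det v != 0.
Proof. by rewrite unitmxE; apply: contraTneq => ->; rewrite unitr0. Qed.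

Lemma GL2_poly_det_neq0 g h (P : 'M[poly]_2) :
  val h = val g *m poly_mx P -> \det P != 0.
Proof.
move=> hE; have := valP h; rewrite unitmxE unitfE hE det_mulmx mulf_eq0 negb_or.
by move=> /andP[_]; apply: contraNneq => P0; rewrite det_poly_mx P0 raddf0.
Qed.

Lemma lattice_sub g h : lattice_of h `<=` lattice_of g ->
  exists P : 'M[poly]_2, val h = val g *m poly_mx P.
Proof.
move=> hg; have colj j : exists w : 'cV[poly]_2, col j (val h) = val g *m map_mx iota w.
  have [|w wE] := hg (col j (val h)); last by exists w.
  by exists (delta_mx j 0); rewrite map_delta_mx colE.
have /choice[W WP] := colj; exists (\matrix_(i, j) W j i 0).
apply/matrixP => i j; have /matrixP/(_ i 0) := WP j; rewrite !mxE => ->.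
by apply: eq_bigr => l _; rewrite !mxE.
Qed.

Lemma GL2_cancel g (m : nat) (v w : 'M[K]_(2, m)) : val g *m v = val g *m w -> v = w.
Proof. by move=> /(congr1 (mulmx (invmx (val g)))); rewrite !mulKmx ?(valP g). Qed.

(** The determinant of [P] divides [nu], because some matrix [Q] of determinant [nu]
    maps into the sublattice. If [phi] vanishes modulo [nu] at the first basis vector,
    [Q] is diagonal with entries [1] and [nu]; otherwise a Bezout relation for this
    value and [nu] gives the second column of [Q]. *)
Lemma cyclic_quotient_det (nu : poly) g h : irreducible_poly nu ->
  cyclic_quotient nu (lattice_of g) (lattice_of h) ->
  exists2 P : 'M[poly]_2, val h = val g *m poly_mx P & (pdeg (\det P) <= pdeg nu)%N.
Proof.
move=> nu_irr [hg [phi [phiD phiZ phi_surj phi_ker]]].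
have [P hE] := lattice_sub hg; exists P => //.
have nu0 : nu != 0 by case: nu_irr => + _; case: eqP => // ->; rewrite size_poly0.
pose L := lattice_of g; pose e (i : 'I_2) : 'cV[K]_2 := val g *m delta_mx i 0.
have Le i : L (e i) by exists (delta_mx i 0); rewrite map_delta_mx.
pose vec (s t : poly) : 'cV[K]_2 := iota s *: e 0 + iota t *: e 1.
have LZ (s : poly) v : L v -> L (iota s *: v).
  move=> [w ->]; exists (s *: w); rewrite scalemxAr; congr (_ *m _).
  by apply/matrixP => i j; rewrite !mxE rmorphM.
have vecE (w : 'cV[poly]_2) : val g *m map_mx iota w = vec (w 0 0) (w 1 0).
  rewrite /vec /e !scalemxAr -mulmxDr; congr (_ *m _); apply/matrixP => i j.
  rewrite !mxE ord1 !andbT; case: i => [[|[|//]] ?] /=.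
    by rewrite mulr1 mulr0 addr0; congr (iota (w _ _)); apply/val_inj.
  by rewrite mulr1 mulr0 add0r; congr (iota (w _ _)); apply/val_inj.
have phi_vec s t : nu %| phi (vec s t) - (s * phi (e 0) + t * phi (e 1)).
  have := dvdp_add (phiD _ _ (LZ s _ (Le 0)) (LZ t _ (Le 1)))
    (dvdp_add (phiZ s _ (Le 0)) (phiZ t _ (Le 1))).
  congr (_ %| _); rewrite -/(vec s t).
  by move: (phi (vec s t)) (phi (_ *: _)) (phi (_ *: _)) => u v w; ring.
have vecL s t : nu %| s * phi (e 0) + t * phi (e 1) ->
    exists w : 'cV[poly]_2, vec s t = val h *m map_mx iota w.
  move=> st; have Lv : L (vec s t).
    exists (\col_i if i == 0 then s else t); rewrite vecE !mxE; exact: erefl.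
  have : nu %| phi (vec s t).
    by have := dvdp_add (phi_vec s t) st; rewrite subrK.
  by rewrite phi_ker // => /asboolP.
have [Q [W [Q0 QP]]] : exists Q W : 'M[poly]_2, \det Q = nu /\ Q = P *m W.
  have cols (s0 t0 s1 t1 : poly) : nu %| s0 * phi (e 0) + t0 * phi (e 1) ->
      nu %| s1 * phi (e 0) + t1 * phi (e 1) -> s0 * t1 - s1 * t0 = nu ->
      exists Q W : 'M[poly]_2, \det Q = nu /\ Q = P *m W.
    move=> /vecL[w0 w0E] /vecL[w1 w1E] st.
    pose s j := if j == 0 :> 'I_2 then s0 else s1.
    pose t j := if j == 0 :> 'I_2 then t0 else t1.
    pose w j := if j == 0 :> 'I_2 then w0 else w1.
    pose Q : 'M[poly]_2 := \matrix_(i, j) if i == 0 then s j else t j.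
    exists Q, (\matrix_(i, j) w j i 0); split; first by rewrite det2E !mxE.
    apply/matrixP => i j; apply: (@laurent_poly_inj F).
    have colE : val g *m map_mx iota (\col_k (Q k j)) =
        val g *m (map_mx iota (P *m w j)).
      rewrite vecE !mxE /= map_mxM mulmxA -hE /s /t /w.
      by case: (j == 0).
    have /matrixP/(_ i 0) := GL2_cancel colE; rewrite !mxE => ->.
    by rewrite !rmorph_sum; apply: eq_bigr => k _; rewrite !mxE.
  have [a0|a0] := boolP (nu %| phi (e 0)).
    apply: (cols 1 0 0 nu); last by rewrite mul1r mul0r subr0.
      by rewrite mul1r mul0r addr0.
    by rewrite mul0r add0r dvdp_mulr.
  have : coprimep (phi (e 0)) nu.
    by rewrite coprimep_sym irreducible_poly_coprime.
  move=> /Bezout_eq1_coprimepP[[c d] /= cd].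
  apply: (cols nu 0 (- c * phi (e 1)) 1).
  - by rewrite mul0r addr0 dvdp_mulr.
  - by apply/dvdpP; exists (d * phi (e 1)); rewrite -cd; ring.
  - by rewrite mulr1 mulr0 subr0.
apply: pdeg_dvd => //; apply/dvdpP; exists (\det W).
by rewrite -Q0 QP det_mulmx mulrC.
Qed.

End Walks.

Section Rays.
Variable F : finFieldType.
Local Notation K := (laurent F).
Local Notation X := (X_infty F).
Local Notation poly := {poly F}.
Local Notation iota := (@laurent_poly F).
Implicit Types (g h : GL2 F) (x y : X).
Variable nu : poly.
Hypothesis nu_irr : irreducible_poly nu.

Lemma nu_neq0 : nu != 0.
Proof. by case: nu_irr => + _; case: eqP => // ->; rewrite size_poly0. Qed.

Lemma nuX_neq0 n : nu ^+ n != 0.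
Proof. by rewrite expf_neq0 ?nu_neq0. Qed.

Lemma pdeg_nu : (0 < pdeg nu)%N.
Proof. by case: nu_irr => + _; rewrite /pdeg; case: (size nu) => [|[]]. Qed.

(** A bound for the distance between the class of [h] and [y], expressed by matrices:
    the determinant of the transition matrix replaces the number of edges. *)
Definition within (d : nat) h y := exists (P : 'M[poly]_2) (h' : GL2 F),
  [/\ class_of h' = y, val h' = val h *m poly_mx P & (pdeg (\det P) <= d)%N].

Lemma hecke_step_within x y h : hecke_step nu x y -> class_of h = x ->
  within (pdeg nu) h y.
Proof.
move=> [L [L' [[g gx gL] [g' g'y g'L'] LL']]] hx; rewrite -gL -g'L' in LL'.
have [P g'E Pnu] := cyclic_quotient_det nu_irr LL'.
have /class_of_eqP/asboolP[c [v [c0 vU gE]]] : class_of h = class_of g by rewrite hx.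
have P0 := GL2_poly_det_neq0 g'E.
have dv0 := unit_det_neq0 vU.
have vP0 : \det (v *m P) != 0 by rewrite det_mulmx mulf_neq0.
exists (v *m P), (GL2_mul h (toGL2 (poly_mx_unit vP0))); split=> //; last first.
  rewrite det_mulmx pdegM // (pdeg_unit (_ : \det v \is a GRing.unit)) //.
rewrite -g'y; apply/class_of_eqP/asboolP; exists c, 1%:M; split; rewrite ?unitmx1 //.
have -> : val (GL2_mul h (toGL2 (poly_mx_unit vP0))) = val h *m poly_mx (v *m P) by [].
by rewrite map_mx1 mulmx1 g'E gE -scalemxAl poly_mxM mulmxA.
Qed.

Lemma det_adj2 (P : 'M[poly]_2) : \det P != 0 -> \det (\adj P) = \det P.
Proof.
move=> P0; apply: (mulfI P0); rewrite -det_mulmx mul_mx_adj det_scalar.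
by rewrite expr2.
Qed.

(** Going back along an edge is multiplying by the adjugate, which is the inverse up to
    a scalar and has the same determinant. *)
Lemma hecke_step_sym_within x y h : hecke_step nu y x -> class_of h = x ->
  within (pdeg nu) h y.
Proof.
move=> yx hx; have [P [h' [h'x h'E Pnu]]] := hecke_step_within yx (class_of_repr y).
have /class_of_eqP/asboolP[c [v [c0 vU hE]]] : class_of h = class_of h' by rewrite hx.
have P0 := GL2_poly_det_neq0 h'E.
have dv0 := unit_det_neq0 vU.
have vP0 : \det (v *m \adj P) != 0 by rewrite det_mulmx (det_adj2 P0) mulf_neq0.
exists (v *m \adj P), (GL2_mul h (toGL2 (poly_mx_unit vP0))); split=> //; last first.
  by rewrite det_mulmx (det_adj2 P0) pdegM // (pdeg_unit (_ : \det v \is a GRing.unit)).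
rewrite -[y]class_of_repr; apply/class_of_eqP/asboolP.
have iP0 : iota (\det P) != 0 by rewrite raddf_eq0 //; exact: laurent_poly_inj.
exists (c / iota (\det P)), 1%:M; split; rewrite ?unitmx1 //.
  by rewrite mulf_neq0 ?invr_eq0.
have -> : val (GL2_mul h (toGL2 (poly_mx_unit vP0))) =
  val h *m poly_mx (v *m \adj P) by [].
have adjE : poly_mx P *m poly_mx (\adj P) = (iota (\det P))%:M.
  by rewrite -poly_mxM mul_mx_adj /poly_mx map_scalar_mx.
have E : val (repr y) *m (iota (\det P))%:M = c *: (val h *m poly_mx (v *m \adj P)).
  by rewrite -adjE mulmxA -h'E hE poly_mxM -scalemxAl mulmxA.
rewrite map_mx1 mulmx1 mulrC -scalerA -E mul_mx_scalar scalerA mulVf //.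
by rewrite scale1r.
Qed.

Lemma within_trans d e h h' y : within e h (class_of h') -> within d h' y ->
  within (e + d) h y.
Proof.
move=> [P [h1 [h1E h1P Pe]]] [Q [h2 [h2y h2Q Qd]]].
have /class_of_eqP/asboolP[c [v [c0 vU h'E]]] := h1E.
have P0 := GL2_poly_det_neq0 h1P; have Q0 := GL2_poly_det_neq0 h2Q.
have dv0 := unit_det_neq0 vU.
have PvQ0 : \det (P *m v *m Q) != 0 by rewrite !det_mulmx !mulf_neq0.
exists (P *m v *m Q), (GL2_mul h (toGL2 (poly_mx_unit PvQ0))); split=> //; last first.
  rewrite !det_mulmx !pdegM ?mulf_neq0 // (pdeg_unit (_ : \det v \is a GRing.unit)) //.
  by rewrite addn0 leq_add.
rewrite -h2y; apply/class_of_eqP/asboolP; exists c, 1%:M; split; rewrite ?unitmx1 //.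
have -> : val (GL2_mul h (toGL2 (poly_mx_unit PvQ0))) = val h *m poly_mx (P *m v *m Q).
  by [].
by rewrite map_mx1 mulmx1 h2Q h'E h1P !poly_mxM -scalemxAl !mulmxA.
Qed.

Lemma hecke_walk_within k x y h : hecke_walk nu k x y -> class_of h = x ->
  within (k * pdeg nu) h y.
Proof.
move=> [p [p0 <- pe]] hx; have : forall i, (i <= k)%N -> within (i * pdeg nu) h (p i).
  elim=> [_|i IH ik].
    exists 1%:M, h; rewrite poly_mx1 mulmx1 p0; split=> //.
    by rewrite det1 /pdeg size_poly1.
  rewrite mulSn addnC; apply: (@within_trans _ _ _ (repr (p i))).
    by rewrite class_of_repr; apply: IH; exact: ltnW.
  have [st|st] := pe i ik.
    exact: hecke_step_within st (class_of_repr _).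
  exact: hecke_step_sym_within st (class_of_repr _).
exact.
Qed.

(** * Rays and ends *)

Definition level_mx (n : nat) (b : poly) : 'M[poly]_2 :=
  \matrix_(i, j) if i == 0 then (j == 0)%:R else if j == 0 then b else nu ^+ n.

Lemma det_level_mx n b : \det (level_mx n b) = nu ^+ n.
Proof. by rewrite det2E !mxE /= mul1r mul0r subr0. Qed.

Lemma det_level_mx_neq0 n b : \det (level_mx n b) != 0.
Proof. by rewrite det_level_mx nuX_neq0. Qed.

Lemma level_mxM m n b b' :
  level_mx m b *m level_mx n b' = level_mx (m + n) (b + nu ^+ m * b').
Proof.
apply/matrixP => i j; rewrite mxE !big_ord_recl big_ord0 !mxE /= exprD.
case: (i == 0); case: (j == 0); rewrite /=; ring.
Qed.

Lemma level_mx_row0 n b (v : 'M[poly]_2) j : (level_mx n b *m v) 0 j = v 0 j.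
Proof. by rewrite mxE !big_ord_recl big_ord0 !mxE /= mul1r mul0r !addr0. Qed.

Variable g : GL2 F.

Definition level n b : GL2 F :=
  GL2_mul g (toGL2 (poly_mx_unit (det_level_mx_neq0 n b))).

Lemma val_level n b : val (level n b) = val g *m poly_mx (level_mx n b).
Proof. by []. Qed.

(** The first rows [(1, 0)] force the scalar [c] to be a unit of [F[Y]]; the second rows
    then give the two assertions. *)
Lemma level_inj n n' b b' : class_of (level n b) = class_of (level n' b') ->
  n = n' /\ nu ^+ n %| b - b'.
Proof.
move=> /class_of_eqP/asboolP[c [v [c0 vU E]]].
have {}E : poly_mx (level_mx n' b') = c *: poly_mx (level_mx n b *m v).
  apply: (@GL2_cancel _ g); rewrite -val_level E val_level -scalemxAr poly_mxM.
  by rewrite mulmxA.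
have ent i j : iota (level_mx n' b' i j) = c * iota ((level_mx n b *m v) i j).
  by have /matrixP/(_ i j) := E; rewrite !mxE.
have row0 j := level_mx_row0 n b v j.
have row1 j : (level_mx n b *m v) 1 j = b * v 0 j + nu ^+ n * v 1 j.
  rewrite mxE !big_ord_recl big_ord0 !mxE /= addr0.
  by rewrite (_ : lift 0 0 = 1) //; apply/val_inj.
have c00 : c * iota (v 0 0) = 1 by rewrite -row0 -ent mxE /= rmorph1.
have v01 : v 0 1 = 0.
  have := ent 0 1; rewrite row0 mxE /= rmorph0 => /esym/eqP.
  by rewrite mulf_eq0 (negPf c0) /= raddf_eq0; [move/eqP|exact: laurent_poly_inj].
have detv : \det v = v 0 0 * v 1 1 by rewrite det2E v01 mul0r subr0.
have : v 0 0 * v 1 1 \is a GRing.unit by rewrite -detv -unitmxE.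
rewrite unitrM => /andP[v00 v11].
have cE : c = iota (v 0 0)^-1.
  have iv0 : iota (v 0 0) != 0.
    by apply: contra_eq_neq c00 => ->; rewrite mulr0 eq_sym oner_neq0.
  by apply: (mulIf iv0); rewrite c00 -rmorphM mulVr // rmorph1.
have E11 : nu ^+ n' = (v 0 0)^-1 * (nu ^+ n * v 1 1).
  apply: (@laurent_poly_inj F); have := ent 1 1.
  by rewrite row1 v01 mulr0 add0r mxE /= cE -rmorphM.
have E10 : b' = (v 0 0)^-1 * (b * v 0 0 + nu ^+ n * v 1 0).
  by apply: (@laurent_poly_inj F); have := ent 1 0; rewrite row1 mxE /= cE -rmorphM.
split.
  have := congr1 (@pdeg F) E11; have nX := nuX_neq0.
  have u0 (p : poly) : p \is a GRing.unit -> p != 0.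
    by apply: contraTneq => ->; rewrite unitr0.
  have i00 : (v 0 0)^-1 \is a GRing.unit by rewrite unitrV.
  rewrite (pdegM (u0 _ i00) (mulf_neq0 (nX n) (u0 _ v11))) (pdegM (nX n) (u0 _ v11)).
  rewrite (pdeg_unit i00) (pdeg_unit v11) addn0 add0n !pdegX ?nu_neq0 //.
  by move/eqP; rewrite eqn_pmul2r ?pdeg_nu // => /eqP ->.
apply/dvdpP; exists (- ((v 0 0)^-1 * v 1 0)); rewrite E10 mulrDr.
rewrite [_ * (b * _)]mulrCA mulVr // mulr1; ring.
Qed.

End Rays.

Section Ends.
Variable F : finFieldType.
Local Notation K := (laurent F).
Local Notation X := (X_infty F).
Local Notation poly := {poly F}.
Local Notation iota := (@laurent_poly F).
Implicit Types (h : GL2 F).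
Variable nu : poly.
Hypothesis nu_irr : irreducible_poly nu.
Variable g : GL2 F.
Local Notation level := (level nu_irr g).
Local Notation level_mx := (level_mx nu).

Lemma nu_ndvd1 : ~~ (nu %| 1).
Proof. by rewrite dvdp1; case: nu_irr; rewrite ltn_neqAle eq_sym => /andP[]. Qed.

(** In the coordinates [w] given by [h], the quotient map is [w 1 0 - e * w 0 0]. *)
Lemma hecke_step_level_mx h h' e : val h' = val h *m poly_mx (level_mx 1 e) ->
  hecke_step nu (class_of h) (class_of h').
Proof.
move=> h'E; exists (lattice_of h), (lattice_of h'); split; [by exists h|by exists h'|].
pose W v := xget 0 [set w : 'cV[poly]_2 | v = val h *m map_mx iota w].
have WE w : W (val h *m map_mx iota w) = w.
  apply: xget_unique => // w' /GL2_cancel ww'; apply/matrixP => i j.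
  by apply: (@laurent_poly_inj F); have /matrixP/(_ i j) := ww'; rewrite !mxE.
pose phi v := W v 1 0 - e * W v 0 0.
have sub : lattice_of h' `<=` lattice_of h.
  by move=> _ [w ->]; exists (level_mx 1 e *m w); rewrite h'E map_mxM mulmxA.
split=> //; exists phi; split.
- move=> _ _ [w ->] [w' ->]; rewrite -mulmxDr -map_mxD /phi !WE !mxE.
  by rewrite [X in _ %| X](_ : _ = 0) ?dvdp0 //; ring.
- move=> r _ [w ->].
  have -> : iota r *: (val h *m map_mx iota w) = val h *m map_mx iota (r *: w).
    by rewrite scalemxAr map_mxZ.
  rewrite /phi !WE !mxE.
  by rewrite [X in _ %| X](_ : _ = 0) ?dvdp0 //; ring.
- move=> r; exists (val h *m map_mx iota (\col_i (if i == 0 then 0 else r))).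
    by exists (\col_i (if i == 0 then 0 else r)).
  by rewrite /phi WE !mxE /= mulr0 subr0 subrr dvdp0.
- move=> _ [w ->]; rewrite /phi WE; apply/idP/asboolP.
    move=> /dvdpP[q qE]; exists (\col_i if i == 0 then w 0 0 else q).
    rewrite h'E -mulmxA -map_mxM; congr (_ *m map_mx _ _).
    apply/matrixP => i j; rewrite ord1 mxE !big_ord_recl big_ord0 !mxE /= !addr0.
    case: (eqVneq i 0) => [->|i0]; first by rewrite mul1r mul0r addr0.
    have -> : i = 1 by apply/val_inj; case: i i0 => [[|[|]]].
    rewrite expr1 [nu * q]mulrC -qE. ring.
  move=> [w' E]; rewrite h'E -mulmxA -map_mxM in E.
  have -> : w = level_mx 1 e *m w' by rewrite -[LHS]WE E WE.
  rewrite !mxE !big_ord_recl !big_ord0 !mxE /= !addr0 expr1 mul1r mul0r addr0.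
  by rewrite addrAC subrr add0r dvdp_mulr.
Qed.

Definition digits (beta : nat -> bool) n : poly := \sum_(i < n) nu ^+ i *+ beta i.

Lemma digitsD beta m n : digits beta (m + n) =
  digits beta m + nu ^+ m * digits (fun i => beta (m + i)%N) n.
Proof.
rewrite /digits big_split_ord /=; congr (_ + _); rewrite mulr_sumr.
by apply: eq_bigr => i _; rewrite exprD mulrnAr.
Qed.

Definition ray beta n : X := class_of (level n (digits beta n)).

Lemma val_levelD beta m n : val (level (m + n) (digits beta (m + n))) =
  val (level m (digits beta m)) *m
  poly_mx (level_mx n (digits (fun i => beta (m + i)%N) n)).
Proof.
set b := digits _ n; have E : level_mx (m + n) (digits beta (m + n)) =
    level_mx m (digits beta m) *m level_mx n b by rewrite level_mxM -digitsD.
apply: etrans (val_level _ _ _ _) _; rewrite E poly_mxM; exact: mulmxA.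
Qed.

Lemma ray0 beta : ray beta 0 = class_of g.
Proof.
congr class_of; apply: val_inj; rewrite val_level -[RHS]mulmx1; congr (_ *m _).
rewrite -poly_mx1; congr poly_mx; apply/matrixP => i j.
rewrite !mxE /digits big_ord0 expr0.
by case: i => [[|[|]] ?] //; case: j => [[|[|]] ?].
Qed.

Lemma ray_edge beta n : hecke_edge nu (ray beta n) (ray beta n.+1).
Proof.
left; apply: (@hecke_step_level_mx _ _ (digits (fun i => beta (n + i)%N) 1)).
by rewrite -val_levelD addn1.
Qed.

(** A matrix with first row [(1, 0)] is primitive, so that a scalar multiple with
    polynomial entries has a determinant of at least the same degree. *)
Lemma ray_geodesic_dist beta m n k :
  hecke_walk nu k (ray beta m) (ray beta (m + n)) -> (n <= k)%N.
Proof.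
move=> walk; have [P [h' [h'E h'P Pk]]] := hecke_walk_within nu_irr walk erefl.
have /class_of_eqP/asboolP[c [v [c0 vU hE]]] := esym h'E.
set b := digits (fun i => beta (m + i)%N) n.
have PE : poly_mx P = c *: poly_mx (level_mx n b *m v).
  apply: (@GL2_cancel _ (level m (digits beta m))).
  apply: etrans (esym h'P) _; apply: etrans hE _.
  apply: etrans (congr1 (fun M => c *: (M *m poly_mx v)) (val_levelD beta m n)) _.
  move: (val (level m _)) => A; rewrite poly_mxM -scalemxAr; congr (_ *: _).
  exact: esym (mulmxA _ _ _).
have row0 j := level_mx_row0 nu n b v j.
have PE0 j : iota (P 0 j) = c * iota (v 0 j).
  by have /matrixP/(_ 0 j) := PE; rewrite mxE [RHS]mxE => ->; rewrite mxE row0.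
pose c' := \sum_j P 0 j * invmx v j 0.
have cE : c = iota c'.
  have : (v *m invmx v) 0 0 = 1 by rewrite mulmxV // mxE.
  rewrite mxE => /(congr1 iota); rewrite rmorph1 rmorph_sum => v1.
  rewrite -[LHS]mulr1 -v1 mulr_sumr /c' rmorph_sum; apply: eq_bigr => j _.
  rewrite [in LHS]rmorphM mulrA; apply: etrans _ (esym (rmorphM iota _ _)).
  by congr (_ * _); exact: esym (PE0 j).
have PE' : P = c' *: (level_mx n b *m v).
  apply: poly_mx_inj; rewrite PE cE; apply/matrixP => i j.
  by rewrite !mxE -rmorphM.
have detPE : \det P = c' ^+ 2 * (nu ^+ n * \det v).
  by rewrite PE' detZ det_mulmx det_level_mx.
have c'0 : c' != 0.
  by apply: contraNneq c0 => c'0; rewrite cE c'0 raddf0.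
have vd : \det v \is a GRing.unit by rewrite -unitmxE.
have vd0 := unit_det_neq0 vU.
have nX := nuX_neq0 nu_irr n.
have c2 : c' ^+ 2 != 0 by rewrite expf_neq0.
move: Pk; rewrite detPE (pdegM c2 (mulf_neq0 nX vd0)) (pdegM nX vd0).
rewrite (pdeg_unit vd) addn0 (pdegX _ (nu_neq0 nu_irr)) => Pk.
rewrite -(@leq_pmul2r (pdeg nu)) ?(pdeg_nu nu_irr) //.
exact: leq_trans (leq_addl _ _) Pk.
Qed.

Lemma ray_geodesic beta : geodesic_ray nu (class_of g) (ray beta).
Proof.
split=> [n|n|m n k]; [|exact: ray_edge|exact: ray_geodesic_dist].
exists n, (ray beta); split=> [||i _]; [exact: ray0|exact: erefl|exact: ray_edge].
Qed.

Lemma digits_inj n : forall beta beta' : nat -> bool,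
  nu ^+ n %| digits beta n - digits beta' n -> forall i, (i < n)%N -> beta i = beta' i.
Proof.
elim: n => [//|n IH] beta beta'.
have digS b : digits b n.+1 = (b 0%N)%:R + nu * digits (fun i => b i.+1) n.
  rewrite -[n.+1]/(1 + n)%N digitsD /digits big_ord1 expr0 expr1; congr (_ + _).
rewrite !digS exprS => nudvd.
have b0 : beta 0%N = beta' 0%N.
  have : nu %| (beta 0%N)%:R - (beta' 0%N)%:R.
    have := dvdp_trans (dvdp_mulr (nu ^+ n) (dvdpp nu)) nudvd.
    have -> : (beta 0%N)%:R + nu * digits (fun i => beta i.+1) n -
        ((beta' 0%N)%:R + nu * digits (fun i => beta' i.+1) n) =
        nu * (digits (fun i => beta i.+1) n - digits (fun i => beta' i.+1) n) +
        ((beta 0%N)%:R - (beta' 0%N)%:R) by ring.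
    by rewrite dvdp_addr // dvdp_mulr.
  case: (beta 0%N); case: (beta' 0%N) => //=.
    by rewrite subr0 (negPf nu_ndvd1).
  by rewrite sub0r dvdpNr (negPf nu_ndvd1).
move: nudvd; rewrite b0.
have -> : (beta' 0%N)%:R + nu * digits (fun i => beta i.+1) n -
    ((beta' 0%N)%:R + nu * digits (fun i => beta' i.+1) n) =
    nu * (digits (fun i => beta i.+1) n - digits (fun i => beta' i.+1) n) by ring.
rewrite dvdp_mul2l ?(nu_neq0 nu_irr) // => /IH bb' [|i] //= ilt.
exact: bb'.
Qed.

(** By [level_inj] two rays can only meet at equal times. *)
Lemma same_end_digits beta beta' : same_end (ray beta) (ray beta') -> beta = beta'.
Proof.
move=> [m [n mn]]; have E k : (m + k)%N = (n + k)%N /\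
    nu ^+ (m + k) %| digits beta (m + k) - digits beta' (n + k).
  exact: level_inj (mn k).
have [/addIn mnE _] := E 0%N; apply/funext => i.
have [_] := E i.+1; rewrite -mnE => /digits_inj; apply.
by rewrite addnS ltnS leq_addl.
Qed.

Definition end_of beta : set (nat -> X) :=
  [set s | geodesic_ray nu (class_of g) s /\ same_end (ray beta) s].

Lemma end_of_mem beta : end_of beta (ray beta).
Proof. by split; [exact: ray_geodesic|exists 0%N, 0%N]. Qed.

Lemma end_of_hecke beta : hecke_ends nu (class_of g) (end_of beta).
Proof. by exists (ray beta) => //; exact: ray_geodesic. Qed.

Lemma end_of_inj : injective end_of.
Proof.
move=> beta beta' E; apply: same_end_digits.
by have := end_of_mem beta'; rewrite -E => -[].
Qed.

End Ends.

(** Cantor's diagonal argument. *)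
Lemma uncountable_range (T : Type) (A : set T) (f : (nat -> bool) -> T) :
  injective f -> (forall s, A (f s)) -> ~ countable A.
Proof.
move=> f_inj fA /countable_injP[e e_inj].
pose D n := `[< exists2 s, e (f s) = n & ~~ s n >].
have De s : e (f s) = e (f D) -> s = D.
  by move=> ee; apply: f_inj; apply: e_inj; rewrite ?inE.
set n := e (f D) in De; have [Dn|Dn] := boolP (D n).
  by have /asboolP[s sn] := Dn; rewrite (De s sn) Dn.
suff : D n by rewrite (negPf Dn).
by apply/asboolP; exists D.
Qed.

(** * Periods and cuspidal excursions along a ray *)

Lemma val_GL2_mul (F : finFieldType) (g h : GL2 F) :
  val (GL2_mul g h) = val g *m val h.
Proof. by []. Qed.

Section Excursions.
Variable F : finFieldType.
Local Notation K := (laurent F).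
Local Notation X := (X_infty F).
Local Notation poly := {poly F}.
Local Notation iota := (@laurent_poly F).
Variable nu : poly.
Hypothesis nu_irr : irreducible_poly nu.
Variable g : GL2 F.
Local Notation level := (level nu_irr g).
Local Notation level_mx := (level_mx nu).

(** If [diag(f, 1) g = k g u] with [u] integral, then [diag(f ^+ J, 1)] fixes the class
    of [g (level_mx n b)] as soon as [u ^+ J] is trivial modulo [nu ^+ n], and by
    [unit_power] a multiple [J] of [p ^ m] suffices. *)
Lemma ray_period (p : nat) (f : K) (T : nat) :
  p \in [pchar F] -> (0 < T)%N -> has_degree f T%:Z ->
  torus_act f (class_of g) = class_of g ->
  exists2 T' : nat, (0 < T')%N & forall m n b, (n <= p ^ m)%N ->
    exists2 f' : K, has_degree f' (T' * p ^ m)%N%:Z &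
      torus_act f' (class_of (level n b)) = class_of (level n b).
Proof.
move=> pF T0 fT fg; have f0 := has_degree_neq0 fT.
have /class_of_eqP/asboolP[k [u [k0 uU fgE]]] :
    class_of g = class_of (GL2_mul (diag1 f) g).
  by rewrite -[LHS]fg /torus_act GL2_act_class_of.
have nu1 : (1 < size nu)%N by case: nu_irr.
have [r [N [r0 ur]]] := unit_order nu1 uU.
exists (T * r)%N; first by rewrite muln_gt0 T0.
move=> m n b nm; set q := (p ^ m)%N in nm *; set J := (r * q)%N.
have [N1 uJ] := unit_power pF ur m.
rewrite -exprM -/q -/J in uJ.
have fJ : has_degree (f ^+ J) (T * r * q)%N%:Z.
  by have := has_degreeX J fT; rewrite -mulr_natr natz -PoszM mulnA.
exists (f ^+ J) => //.
have powE j : val (diag1 (f ^+ j)) *m val g = k ^+ j *: (val g *m poly_mx (u ^+ j)).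
  elim: j => [|j IH].
    by rewrite !expr0 diag1_1 scale1r poly_mx1 mulmx1 mul1mx.
  have fj0 : f ^+ j != 0 by rewrite expf_neq0.
  have -> : val (diag1 (f ^+ j.+1)) = val (diag1 (f ^+ j)) *m val (diag1 f).
    by rewrite exprSr (diag1M fj0 f0).
  have fgE' : val (diag1 f) *m val g = k *: (val g *m poly_mx u) := fgE.
  rewrite -mulmxA fgE' -scalemxAr mulmxA IH -scalemxAl scalerA -exprS.
  by rewrite -mulmxA -poly_mxM [u ^+ j.+1]exprSr.
set M := level_mx n b; have detM : \det M = nu ^+ n := det_level_mx nu n b.
have [N2 AE] : exists N2 : 'M[poly]_2, u ^+ J = 1%:M + nu ^+ n *: N2.
  exists (nu ^+ (q - n) *: N1); rewrite uJ scalerA -exprD subnKC //.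
(* The conjugate of [u ^+ J] by [M] is integral because [\adj M *m M] is [nu ^+ n]. *)
pose u' := 1%:M + \adj M *m N2 *m M.
have Mu' : M *m u' = u ^+ J *m M.
  rewrite /u' AE mulmxDr mulmx1 mulmxDl mul1mx !mulmxA mul_mx_adj detM.
  by rewrite mul_scalar_mx.
have u'U : u' \in unitmx.
  have nX := nuX_neq0 nu_irr n.
  have : \det M * \det u' = \det M * \det (u ^+ J).
    by rewrite -det_mulmx Mu' det_mulmx mulrC.
  rewrite detM unitmxE => /(mulfI nX) ->; rewrite -unitmxE.
  by have : u ^+ J \is a GRing.unit := unitrX J uU.
rewrite /torus_act GL2_act_class_of; apply: esym; apply/class_of_eqP/asboolP.
exists (k ^+ J), u'; split; [by rewrite expf_neq0|exact: u'U|].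
have := val_level nu_irr g n b; rewrite -/M; move: (level n b) => L LE.
rewrite (val_GL2_mul _ L) LE mulmxA powE -scalemxAl -!mulmxA; congr (_ *: (_ *m _)).
by rewrite -poly_mxM -Mu' poly_mxM.
Qed.

(** The first column of the matrix has degree at most [t + G + B], while its determinant
    has degree [t + delta + n * pdeg nu]. *)
Lemma level_cuspidal (G B N delta : int) (n : nat) b (t : nat) (s : K) :
  mx_le (val g) G -> 0 <= G -> has_degree (\det (val g)) delta ->
  degree_le (iota b) B -> 0 <= B -> has_degree s t%:Z ->
  t%:Z + 2 * G + 2 * B + N <= delta + (n * pdeg nu)%N%:Z ->
  cuspidal N (GL2_mul (diag1 s) (level n b)).
Proof.
move=> gG G0 gd bB B0 st tN; have s0 := has_degree_neq0 st.
have := val_level nu_irr g n b; move: (level n b) => L LE.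
pose w : 'cV[poly]_2 := delta_mx 0 0; exists w, (t%:Z + (G + B)); split.
- by apply/eqP => /matrixP/(_ 0 0) /eqP; rewrite !mxE /= oner_eq0.
- rewrite (val_GL2_mul _ L) LE -!mulmxA -map_mxM.
  apply: mx_leM; last apply: mx_leM gG _.
    move=> i j; rewrite diag1_mxE //; case: (i == j); last exact: degree_le0.
    rewrite mulr1n; case: (i == 0); first by case: st.
    by apply: degree_leW (@degree_le1 F).
  move=> i j; rewrite mxE mxE !big_ord_recl big_ord0 !mxE /=.
  rewrite mulr0 !addr0 ord1 eqxx mulr1; case: (i == 0); last exact: bB.
  by rewrite rmorph1; exact: degree_leW B0 (@degree_le1 F).
rewrite (val_GL2_mul _ L) LE.
rewrite !det_mulmx (det_diag1_mx s0) det_poly_mx det_level_mx.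
have nX := nuX_neq0 nu_irr n.
have := has_degreeM st (has_degreeM gd (has_degree_poly nX)).
rewrite -/(pdeg _) (pdegX _ (nu_neq0 nu_irr)).
by move=> /has_degree_le hd /hd; move: tN; lia.
Qed.

Lemma digits_degree (beta : nat -> bool) (n s : nat) :
  (forall i, (s < i < n)%N -> beta i = false) ->
  degree_le (iota (digits nu beta n)) (s * pdeg nu)%N%:Z.
Proof.
move=> sn; rewrite /digits rmorph_sum; apply: degree_le_sum => i.
have [si|si] := ltnP s i.
  by rewrite sn ?si ?ltn_ord // mulr0n rmorph0.
have nX := nuX_neq0 nu_irr i.
case: (beta i); last by rewrite mulr0n rmorph0.
rewrite mulr1n; apply: degree_leW (has_degree_poly nX).1.
by rewrite -/(pdeg _) (pdegX _ (nu_neq0 nu_irr)) lez_nat leq_mul2r si orbT.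
Qed.

End Excursions.

(** * Escape of mass *)

Lemma ptws_cvg (I : Type) (V : topologicalType) (G : set_system {ptws I -> V})
    (f : {ptws I -> V}) : Filter G ->
  (forall i, (fun h : {ptws I -> V} => h i) @ G --> f i) -> G --> f.
Proof.
move=> GF Gf; apply/cvg_sup => i A [_ [[D oD <-] /= Df DA]].
have GD : G ((fun h : {ptws I -> V} => h i) @^-1` D).
  by apply: (Gf i); apply: open_nbhs_nbhs.
exact: filterS DA GD.
Qed.

Section Escape.
Variables (F : finFieldType) (R : realType).
Local Notation K := (laurent F).
Local Notation X := (X_infty F).
Local Notation B := (g_sigma_algebraType (@open X)).

(** The measures [mu n] converge vaguely along an ultrafilter finer than the subsequence
    [sub]. The bound [1 - c] passes to the limit on each compact clopen set, then to the
    whole space, which is the increasing union of a sequence of such sets. *)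
Lemma accumulation_exists (x : nat -> X) (mu : nat -> probability B R)
    (sub : nat -> nat) (c : R) :
  0 <= c -> (forall n, orbit_measure (x n) (mu n)) -> (forall j, (j <= sub j)%N) ->
  (forall C, compact_clopen C -> exists J, forall j, (J <= j)%N ->
    (mu (sub j) C <= (1 - c)%:E)%E) ->
  exists2 theta, accumulation_measures x theta & (theta [set: B] <= (1 - c)%:E)%E.
Proof.
move=> c0 mu_orb subj mu_esc.
have [b [b_clopen b_base]] := @X_countable_base F.
have [G [GU subG]] := @ultraFilterLemma nat (sub @ \oo) _.
have Goo : \oo `<=` G.
  move=> A [M _ MA]; apply: subG; exists M => // j /= Mj.
  by apply: MA; exact: leq_trans Mj (subj j).
have mC C : compact_clopen C -> measurable (C :
  set B) by exact: compact_clopen_measurable.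
have mu_fin k (A : set B) : measurable A -> mu k A \is a fin_num.
  by move=> mA; exact: fin_num_measure.
pose m k (A : set X) : R := if `[< measurable (A : set B) >] then fine (mu k A) else 0.
have mE k C : compact_clopen C -> m k C = fine (mu k C).
  by move=> cC; rewrite /m asboolT //; exact: mC.
have m01 k A : 0 <= m k A <= 1.
  rewrite /m; case: asboolP => mA; last by rewrite lexx ler01.
  rewrite fine_ge0 ?measure_ge0 //= -lee_fin fineK ?mu_fin //.
  exact: probability_le1.
have m_add k A C : compact_clopen A -> compact_clopen C -> A `&` C = set0 ->
    m k (A `|` C) = m k A + m k C.
  move=> cA cC AC; rewrite !mE //; last exact: compact_clopenU.
  rewrite measureU ?fineD ?mu_fin //; exact: mC.
have [theta thetaP] := vague_limit b_clopen b_base GU m01 m_add.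
have theta_le : (theta setT <= (1 - c)%:E)%E.
  apply: (open_measure_le b_clopen b_base openT) => C cC _.
  have [l -> ml] := thetaP C cC; rewrite lee_fin; apply: (cvgr_to_le ml).
  apply: subG; have [J JP] := mu_esc C cC; exists J => // j /= Jj.
  by rewrite mE // -lee_fin fineK ?mu_fin ?JP //; exact: mC.
have theta1 : (theta setT <= 1)%E.
  by apply: le_trans theta_le _; rewrite lee_fin gerBl.
exists theta; last exact: theta_le.
split.
  move=> A /measurable_compact mA.
  have : (theta A <= theta setT)%E.
    apply: le_measure; [|exact: mem_set measurableT|exact: subsetT].
    exact: mem_set mA.
  by move=> /le_trans/(_ theta1)/le_lt_trans; apply; rewrite ltry.
exists mu; split=> //.
have cvgG : (fun n => functional (mu n)) @ G --> functional theta.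
  apply: ptws_cvg => -[f fP]; have /asboolP[cf kf] := fP.
  apply: (@vague_cvg R X b b_clopen b_base G (fun n => mu n) theta f) => //.
    by move=> k; exact: (eq_ind_r (fun z =>
      (z <= 1)%E) (lexx 1%E) (probability_setT (mu k))).
  move=> C cC; have [l thE ml] := thetaP C cC; rewrite thE /=.
  by under eq_fun do rewrite -mE //.
move=> A D FA nD.
have GA : G ((fun n => functional (mu n)) @^-1` A) by exact: Goo.
have GD : G ((fun n => functional (mu n)) @^-1` D) by exact: cvgG.
have : G ((fun n => functional (mu n)) @^-1` (A `&` D)) by exact: filterI.
by move=> /filter_ex[n ADn]; exists (functional (mu n)).
Qed.

Variable nu : {poly F}.
Hypothesis nu_irr : irreducible_poly nu.
Variable g : GL2 F.
Variable p : nat.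
Hypothesis p_prime : prime p.
Variable T : nat.
Hypothesis T0 : (0 < T)%N.
Hypothesis period : forall m n b, (n <= p ^ m)%N ->
  exists2 f : K, has_degree f (T * p ^ m)%N%:Z &
    torus_act f (class_of (level nu_irr g n b)) = class_of (level nu_irr g n b).

Lemma up_logX m : up_log p (p ^ m) = m.
Proof.
have p1 := prime_gt1 p_prime; apply/eqP; rewrite eqn_leq up_log_min //=.
by rewrite -(leq_exp2l _ _ p1) up_logP.
Qed.

(** Powers of [p] whose successive quotients tend to infinity. *)
Definition free_pos (j : nat) : nat := (p ^ (j ^ 2))%N.

Lemma free_pos_gt0 j : (0 < free_pos j)%N.
Proof. by rewrite expn_gt0 prime_gt0. Qed.

Lemma leq_free_pos j : (j < free_pos j)%N.
Proof.
apply: leq_ltn_trans (ltn_expl (j ^ 2) (prime_gt1 p_prime)).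
by rewrite expnS expn1; case: j => // j; rewrite leq_pmull.
Qed.

Lemma free_pos_grows j : (free_pos j * (2 * j + 2) <= free_pos j.+1)%N.
Proof.
have E : (j.+1 ^ 2 = j ^ 2 + (2 * j + 1))%N by rewrite !expnS !expn0; lia.
rewrite /free_pos E expnD leq_mul2l; apply/orP; right.
have := ltn_expl (2 * j + 1) (prime_gt1 p_prime); lia.
Qed.

(** At the [n]-th vertex, [n = free_pos j.+1], the orbit has period [T * n] because
    [n] is a power of [p]. Its layers of degree [t < n / 2] are far in the cusp,
    because the digits vanish between the much smaller index [free_pos j] and [n].
    This is a proportion [1 / (2 * T)] of the period. *)
Lemma ray_escape (beta : nat -> bool) :
  (forall j i, (free_pos j < i < free_pos j.+1)%N -> beta i = false) ->
  exists2 theta : {measure set B ->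
    \bar R}, accumulation_measures (ray nu_irr g beta) theta &
    (theta [set: B] <= (1 - (2 * T%:R)^-1)%:E)%E.
Proof.
move=> sparse; set c : R := (2 * T%:R)^-1.
pose y n := ray nu_irr g beta n; pose per n := (T * p ^ up_log p n)%N.
have per0 n : (0 < per n)%N by rewrite muln_gt0 T0 expn_gt0 prime_gt0.
have perP n : exists2 f : K, has_degree f (per n)%:Z & torus_act f (y n) = y n.
  by apply: period; apply: up_logP; exact: prime_gt1.
have /choice[mu muP] : forall n, exists mu : probability B R, orbit_measure (y n) mu /\
    forall (C : set X) (r : R), compact_clopen C ->
      (forall k, box_avg R (y n) (per n) k C <= r) -> (mu C <= r%:E)%E.
  move=> n; have [f fn fy] := perP n.
  exact: orbit_measure_exists R _ _ (per0 n) (period_compact (per0 n) fn fy).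
apply: (@accumulation_exists y mu (fun j => free_pos j.+1)) => [|n|j|C cC].
- by rewrite invr_ge0 mulr_ge0 // ler0n.
- by case: (muP n).
- by apply: ltnW; apply: ltnW; exact: leq_free_pos.
have [N CN] : exists N : nat, C `&` cusp N%:Z = set0.
  by apply: compact_avoids_cusp; case: cC.
have [G G0 gG] := mx_leP (val g).
have g0 : \det (val g) != 0 by rewrite -unitfE -unitmxE; exact: (valP g).
have [delta gd] := has_degree_ex g0.
pose A := (2 * `|G| + N + `|delta|)%N.
(* [A] collects the constants of [level_cuspidal]; for large [j], the index [n]
   exceeds them together with the degree of the polynomial given by the digits, which
   is at most [free_pos j * pdeg nu]. *)
exists (2 * A + 4 * pdeg nu + 1)%N => j Jj.
have [_ muC] := muP (free_pos j.+1); apply: muC => // k.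
have [f fn fy] := perP (free_pos j.+1).
set n := free_pos j.+1 in f fn fy *; set l := (n - n./2)%N.
have perE : per n = (T * n)%N by rewrite /per up_logX.
have lper : (l <= per n)%N.
  rewrite perE; apply: leq_trans (leq_subr _ _) _.
  by rewrite leq_pmull.
have n_big : (2 * A + 4 * (free_pos j * pdeg nu) + 2 <= n)%N.
  have := free_pos_grows j; have := free_pos_gt0 j; rewrite -/n; nia.
have lW t : (t < l)%N -> layer (y n) t%:Z `<=` cusp N%:Z.
  move=> tl _ [s st <-]; rewrite /torus_act /y /ray GL2_act_class_of.
  exists (GL2_mul (diag1 s) (level nu_irr g n (digits nu beta n))); last exact: erefl.
  have bB := digits_degree nu_irr (sparse j).
  apply: (level_cuspidal nu_irr gG G0 gd bB _ st); first by [].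
  have d1 := pdeg_nu nu_irr.
  have nd : (n <= n * pdeg nu)%N by rewrite leq_pmulr.
  move: tl n_big nd; rewrite /l /A; set e := (n * pdeg nu)%N.
  set e' := (free_pos j * pdeg nu)%N; lia.
apply: le_trans (box_avg_escape (per0 n) fn fy R k lper lW CN) _.
have T1 : 0 < T%:R :> R by rewrite ltr0n.
have n1 : 0 < n%:R :> R by rewrite ltr0n free_pos_gt0.
have ln : (n%:R : R) <= 2 * l%:R.
  by rewrite -natrM ler_nat /l; lia.
rewrite lerD2l lerN2 /c perE natrM ler_pdivlMr ?mulr_gt0 //.
have -> : (2 * T%:R)^-1 * (T%:R * n%:R) = n%:R / 2 :> R.
  by rewrite invfM mulrA mulfVK ?gt_eqF // mulrC.
by rewrite ler_pdivrMr // mulrC.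
Qed.

End Escape.

Definition spread (p : nat) (eps : nat -> bool) (i : nat) : bool :=
  [exists j : 'I_i.+1, (i == free_pos p j) && eps j].

Section Spread.
Variable p : nat.
Hypothesis p_prime : prime p.

Lemma free_pos_mono : {mono free_pos p : i j / (i <= j)%N}.
Proof.
apply: leq_mono; apply: homo_ltn => [|j]; first exact: ltn_trans.
by rewrite ltn_exp2l ?prime_gt1 // ltn_exp2r.
Qed.

Lemma spread_free_pos eps j : spread p eps (free_pos p j) = eps j.
Proof.
apply/existsP/idP => [[j' /andP[/eqP E]]|epsj].
  case: j' E => j' /= _ E; suff -> : j = j' by []; apply/eqP.
  by rewrite eqn_leq -free_pos_mono -[(j' <= j)%N]free_pos_mono -eqn_leq; apply/eqP.
by exists (Ordinal (leqW (leq_free_pos p_prime j))); rewrite /= eqxx.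
Qed.

Lemma spread_sparse eps j i :
  (free_pos p j < i < free_pos p j.+1)%N -> spread p eps i = false.
Proof.
move=> /andP[ji ij]; apply/negbTE/existsP => -[k /andP[/eqP E _]].
by move: ji ij; rewrite E !ltnNge !free_pos_mono -!ltnNge ltnS => /leq_trans H /H;
  rewrite ltnn.
Qed.

Lemma spread_inj : injective (spread p).
Proof. by move=> e e' E; apply/funext => j;
  rewrite -(spread_free_pos e) E spread_free_pos. Qed.

End Spread.

Theorem theorem3 (F : finFieldType) (R : realType) (nu : {poly F})
    (x0 : X_infty F) (nu_prime : irreducible_poly nu)
    (x0_periodic : A_periodic x0) :
  exists2 c : R, 0 < c &
    ~ countable [set xi | hecke_ends nu x0 xi /\ escape_of_mass x0 c xi].
Proof.
have [p p_prime pF] := finfield.finPcharP F.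
have [f [d [d0 fd fx]]] := compact_orbit_period R x0_periodic.
move: fx; have <- : class_of (repr x0) = x0 by exact: class_of_repr.
move: (repr x0) => g fx.
have [T T0 period] := ray_period nu_prime pF d0 fd fx.
exists (2 * T%:R)^-1; first by rewrite invr_gt0 mulr_gt0 ?ltr0n.
apply: (uncountable_range (f := fun eps => end_of nu_prime g (spread p eps))).
  by move=> e e' /end_of_inj /(spread_inj p_prime).
move=> eps; split; first exact: end_of_hecke.
exists (ray nu_prime g (spread p eps)); split.
- exact: end_of_mem.
- exact: ray0.
apply: (ray_escape R p_prime T0 period) => j i; exact: spread_sparse.
Qed.
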